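(* Let $G$ be a finitely presented group and let $f\colon G\to\mathbb{R}$ be a pseudocharacter, not identically zero, which is not uniform. Then $G$ admits a cobounded quasi-action on a bushy tree.
   Context: **Pseudocharacters.** A function $f\colon G\to\mathbb{R}$ is a pseudocharacter if $f(\alpha^n)=nf(\alpha)$ for all $\alpha\in G$, $n\in\mathbb{Z}$, and there is a constant $C$ with $|f(\alpha)+f(\beta)-f(\alpha\beta)|\le C$ for all $\alpha,\beta\in G$. **The set $E(f)$.** Let $S$ be a finite triangular generating set of $G$, i.e. $G$ has a finite presentation $\langle S\mid R\rangle$ in which every word of $R$ has length three (every finitely presented group has such a presentation). Let $\Gamma(G,S)$ be the Cayley graph (edges joining $g$ to $gs$, each of length one, $G$ acting on the left), and extend $f$ affinely over its edges. For a continuous $\phi\colon\mathbb{R}_+=[0,\infty)\to\Gamma(G,S)$ put $\sigma(\phi)=+1$ if $\lim_{t\to\infty}f(\phi(t))=\infty$, $\sigma(\phi)=-1$ if $\lim_{t\to\infty}f(\phi(t))=-\infty$, and $\sigma(\phi)=0$ otherwise. For $C>0$ write $\phi_1\sim_C\phi_2$ if $\sigma(\phi_1)=\sigma(\phi_2)$ and for every $D$ with $\sigma(\phi_1)D>C$ there is a path $\delta\colon[0,1]\to\Gamma(G,S)$ with $\delta(0)\in\phi_1(\mathbb{R}_+)$, $\delta(1)\in\phi_2(\mathbb{R}_+)$ and $|f(\delta(t))-D|\le C$ for all $t\in[0,1]$. Write $\phi_1\sim\phi_2$ if $\phi_1\sim_C\phi_2$ for some $C$. Then $E(f)=E(f,S)$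 is the set of $\sim$-classes of continuous $\phi$ with $\sigma(\phi)\in\{+1,-1\}$; up to canonical bijection it does not depend on $S$. The pseudocharacter $f$ is *uniform* if $|E(f)|=2$. **Quasi-actions.** A (not necessarily continuous) map $q\colon X\to Y$ of metric spaces is a $(K,C)$-quasi-isometry if $d(x_1,x_2)/K-C\le d(q(x_1),q(x_2))\le Kd(x_1,x_2)+C$ for all $x_1,x_2\in X$ and every $y\in Y$ is within distance $C$ of $q(X)$. A $(K,C)$-quasi-action of $G$ on a metric space $X$ is a map $A\colon G\times X\to X$ such that each $A(g,-)\colon X\to X$ is a $(K,C)$-quasi-isometry and $d(A(g,A(h,x)),A(gh,x))\le C$ for all $g,h\in G$, $x\in X$. A quasi-action is a $(K,C)$-quasi-action for some $K\ge1$, $C\ge 0$. It is cobounded if for every $x\in X$ the map $g\mapsto A(g,x)$ is coarsely onto, i.e. every point of $X$ is within some constant distance of its image. **Bushy trees.** Trees are simplicial trees with the path metric in which edges have length one. A tree is *bushy* if there is a constant $B$ such that removing any metric ball of radius $B$ leaves a space with at least three unbounded path components. *)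

(* Defs.v *)
From HB Require Import structures.
From mathcomp Require Import all_boot all_order all_algebra.
From mathcomp Require Import all_classical all_reals all_analysis.

Set Implicit Arguments.
Unset Strict Implicit.
Unset Printing Implicit Defensive.

Import Order.TTheory GRing.Theory Num.Theory.
Import numFieldNormedType.Exports.

Local Open Scope classical_set_scope.
Local Open Scope ring_scope.

(** * Group presentations *)

(* The letter [(i, false)] stands for the generator [i], and [(i, true)] for
   its inverse; words need not be reduced. *)
Definition word (I : Type) := seq (I * bool).

Definition letter_val (G : groupType) (I : Type) (rho : I -> G)
    (x : I * bool) : G :=
  if x.2 then (rho x.1)^-1%g else rho x.1.

Definition word_val (G : groupType) (I : Type) (rho : I -> G) (w : word I) : G :=
  foldr (fun x g => letter_val rho x * g)%g 1%g w.

(* Equality in the group < I | rel >. *)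
Inductive word_eq (I : eqType) (rel : seq (word I)) : word I -> word I -> Prop :=
| word_eq_refl u : word_eq rel u u
| word_eq_sym u v : word_eq rel u v -> word_eq rel v u
| word_eq_trans u v w : word_eq rel u v -> word_eq rel v w -> word_eq rel u w
| word_eq_cancel u i b v :
    word_eq rel (u ++ (i, b) :: (i, ~~ b) :: v) (u ++ v)
| word_eq_relator u r v : r \in rel -> word_eq rel (u ++ r ++ v) (u ++ v).

(* [rho] induces an isomorphism from < I | rel > onto [G]. *)
Definition presentation (G : groupType) (I : finType) (rho : I -> G)
    (rel : seq (word I)) : Prop :=
  (forall g, exists w, word_val rho w = g) /\
  (forall w, word_val rho w = 1%g <-> word_eq rel w [::]).

Definition finitely_presented (G : groupType) : Prop :=
  exists (I : finType) (rho : I -> G) (rel : seq (word I)),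
    presentation rho rel.

Record triangular_generating_set (G : groupType) := TriangularGeneratingSet {
  generators :> seq G;
  relators : seq (word (seq_sub generators));
  triangular_presentation :
    presentation (val : seq_sub generators -> G) relators;
  triangular_relators : forall r, r \in relators -> size r = 3%N
}.

(** * Graphs *)

(* Loops and multiple edges are allowed. *)
Record graph := Graph {
  vertex : Type;
  edge : Type;
  source : edge -> vertex;
  target : edge -> vertex
}.

(* The oriented edge [(e, true)] is [e] traversed backwards. *)
Definition origin (X : graph) (x : edge X * bool) : vertex X :=
  if x.2 then target x.1 else source x.1.

Definition terminus (X : graph) (x : edge X * bool) : vertex X :=
  if x.2 then source x.1 else target x.1.

Fixpoint walk (X : graph) (u : vertex X) (p : seq (edge X * bool))
    (v : vertex X) : Prop :=
  if p is x :: p' then origin x = u /\ walk (terminus x) p' v else u = v.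

Record connected_graph := ConnectedGraph {
  graph_of :> graph;
  graph_connected : forall u v : vertex graph_of, exists p, walk u p v
}.

Definition reduced (X : graph) (p : seq (edge X * bool)) : Prop :=
  forall p1 e b p2, p <> p1 ++ (e, b) :: (e, ~~ b) :: p2.

(* A nonempty closed walk without backtracking contains a circuit; in
   particular a tree has neither loops nor multiple edges. *)
Definition tree (X : connected_graph) : Prop :=
  inhabited (vertex X) /\
  forall (v : vertex X) p, walk v p v -> reduced p -> p = [::].

(** * Metric graphs *)

Inductive realization (R : realType) (X : connected_graph) :=
| Vertex of vertex X
| Inner of edge X & {t : R | 0 < t < 1}.
Arguments Vertex {R X} _.
Arguments Inner {R X} _ _.

HB.instance Definition _ R X := gen_eqMixin (realization R X).
HB.instance Definition _ R X := gen_choiceMixin (realization R X).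

(* Parametrization of the closed edge [e], from source to target. *)
Definition edge_point (R : realType) (X : connected_graph) (e : edge X) (t : R) :
    realization R X :=
  if insub t is Some u then Inner e u
  else if t <= 0 then Vertex (source e) else Vertex (target e).

(* [piecewise_linear p q l]: a piecewise linear path of length [l] goes from
   [p] to [q]. *)
Inductive piecewise_linear (R : realType) (X : connected_graph) :
    realization R X -> realization R X -> R -> Prop :=
| pl_nil p : piecewise_linear p p 0
| pl_cons e s t q l : 0 <= s <= 1 -> 0 <= t <= 1 ->
    piecewise_linear (edge_point e t) q l ->
    piecewise_linear (edge_point e s) q (`|s - t| + l).

Definition path_dist (R : realType) (X : connected_graph)
    (p q : realization R X) : R :=
  inf [set l | piecewise_linear p q l].

Section path_metric.
Context (R : realType) (X : connected_graph).
Implicit Types p q r : realization R X.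

Lemma edge_point0 (e : edge X) : edge_point e (0 : R) = Vertex (source e).
Proof. by rewrite /edge_point; case: insubP => [u|_]; rewrite ?ltxx ?lexx. Qed.

Lemma edge_point1 (e : edge X) : edge_point e (1 : R) = Vertex (target e).
Proof.
rewrite /edge_point; case: insubP => [u|_]; first by rewrite ltxx andbF.
by rewrite ler10.
Qed.

Lemma edge_point_in (e : edge X) (t : {t : R | 0 < t < 1}) :
  edge_point e (val t) = Inner e t.
Proof. by rewrite /edge_point valK. Qed.

Lemma pl_ge0 p q l : piecewise_linear p q l -> 0 <= l.
Proof. by elim=> // *; rewrite addr_ge0. Qed.

Lemma pl_cat p q r l m : piecewise_linear p q l -> piecewise_linear q r m ->
  piecewise_linear p r (l + m).
Proof.
elim=> [?|e s t q' l' s01 t01 _ IH /IH]; first by rewrite add0r.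
by move=> H; rewrite -addrA; apply: pl_cons.
Qed.

Lemma pl_edge (e : edge X) (s t : R) : 0 <= s <= 1 -> 0 <= t <= 1 ->
  piecewise_linear (edge_point e s) (edge_point e t) `|s - t|.
Proof. by move=> ? ?; rewrite -[X in _ _ X]addr0; apply: pl_cons => //; left. Qed.

Lemma pl_sym p q l : piecewise_linear p q l -> piecewise_linear q p l.
Proof.
elim=> [?|e s t q' l' s01 t01 _ IH]; first exact: pl_nil.
by rewrite addrC; apply: (pl_cat IH); rewrite distrC; apply: pl_edge.
Qed.

Lemma pl_walk (u v : vertex X) w : walk u w v ->
  exists l, piecewise_linear (Vertex u : realization R X) (Vertex v) l.
Proof.
elim: w u => [u <-|[e b] w IH u /= [<- /IH[l ul]]].
  by exists 0; apply: pl_nil.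
have i0 : 0 <= (0 : R) <= 1 by rewrite lexx ler01.
have i1 : 0 <= (1 : R) <= 1 by rewrite lexx ler01.
case: b ul => ul; eexists; apply: pl_cat ul; rewrite /origin /terminus /=;
  rewrite -(edge_point0 e) -(edge_point1 e); exact: pl_edge.
Qed.

Lemma pl_vertex p : exists v l, piecewise_linear p (Vertex v) l.
Proof.
case: p => [v|e t]; first by exists v, 0; apply: pl_nil.
exists (source e); eexists; rewrite -edge_point0 -edge_point_in.
apply: pl_edge; last by rewrite lexx ler01.
by case/andP: (valP t) => ? ?; rewrite !ltW.
Qed.

Lemma pl_exists p q : exists l, piecewise_linear p q l.
Proof.
have [u [l pu]] := pl_vertex p; have [v [m /pl_sym qv]] := pl_vertex q.
have [w /pl_walk[k uv]] := graph_connected u v.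
by exists (l + (k + m)); apply: (pl_cat pu); apply: (pl_cat uv).
Qed.

Let has_inf_pl p q : has_inf [set l | piecewise_linear p q l].
Proof. by split; [exact: pl_exists|exists 0 => l /pl_ge0]. Qed.

Lemma path_dist_le p q l : piecewise_linear p q l -> path_dist p q <= l.
Proof. by move=> pq; apply: ge_inf => //; case: (has_inf_pl p q). Qed.

Lemma path_dist_ge p q a :
  (forall l, piecewise_linear p q l -> a <= l) -> a <= path_dist p q.
Proof. by move=> H; apply: lb_le_inf; [exact: pl_exists|exact: H]. Qed.

Lemma path_distxx p : path_dist p p = 0.
Proof.
apply/eqP; rewrite eq_le path_dist_le ?path_dist_ge//; last exact: pl_nil.
by move=> l /pl_ge0.
Qed.

Lemma path_dist_sym p q : path_dist p q = path_dist q p.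
Proof.
by rewrite /path_dist; congr inf; apply/seteqP; split => l /pl_sym.
Qed.

Lemma path_dist_triangle q p r :
  path_dist p r <= path_dist p q + path_dist q r.
Proof.
rewrite -lerBlDl; apply: path_dist_ge => m qr; rewrite lerBlDl -lerBlDr.
apply: path_dist_ge => l pq; rewrite lerBlDr.
by apply: path_dist_le; apply: pl_cat qr.
Qed.

Lemma path_dist_lipschitz (h : realization R X -> R) p q :
  (forall e s t, 0 <= s <= 1 -> 0 <= t <= 1 ->
    h (edge_point e t) <= h (edge_point e s) + `|s - t|) ->
  h q <= h p + path_dist p q.
Proof.
move=> hL; rewrite -lerBlDl; apply: path_dist_ge => l pq; rewrite lerBlDl.
elim: pq => [?|e s t q' l' s01 t01 _ IH]; first by rewrite addr0.
by rewrite addrA (le_trans IH)// lerD2r hL.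
Qed.

Lemma min_lipschitz (a b a' b' c : R) :
  a <= a' + c -> b <= b' + c -> Num.min a b <= Num.min a' b' + c.
Proof. by move=> ? ?; rewrite addr_minl le_min !ge_min; apply/andP; split; apply/orP; [left|right]. Qed.

Lemma path_dist_separated p q : path_dist p q = 0 -> p = q.
Proof.
move=> pq0; case: p pq0 => [v|e0 [t0 /= t01]] pq0.
- pose E e (t : R) := Num.min (if `[< source e = v >] then t else 1)
                              (if `[< target e = v >] then 1 - t else 1).
  pose h p : R := match p with
    | Vertex u => if `[< u = v >] then 0 else 1
    | Inner e t => E e (val t) end.
  have hE e t : 0 <= t <= 1 -> h (edge_point e t) = E e t.
    move=> /andP[t0 t1]; rewrite /edge_point; case: insubP => [u _ <-//|].
    rewrite negb_and -!leNgt => /orP[t_le0|t_ge1].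
    - have -> : t = 0 by apply/eqP; rewrite eq_le t_le0.
      rewrite lexx /= /E subr0 if_same.
      by case: asboolP => _; rewrite /Num.min ?ltr01 ?ltxx.
    - have -> : t = 1 by apply/eqP; rewrite eq_le t1.
      rewrite ler10 /= /E subrr if_same.
      by case: asboolP => _; rewrite /Num.min ?ltr10 ?ltxx.
  have : h q <= h (Vertex v) + path_dist (Vertex v) q.
    apply: path_dist_lipschitz => e s t s01 t01; rewrite !hE//.
    apply: min_lipschitz; case: ifP => _.
    + by rewrite -lerBlDl (le_trans (ler_norm _))// distrC.
    + by rewrite lerDl.
    + by rewrite -lerBlDl opprB addrC addrA subrK ler_norm.
    + by rewrite lerDl.
  rewrite pq0 addr0 /= asboolT//.
  case: q {pq0} => [u|e [t /= t01]] /=.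
    by case: asboolP => [->//|_]; rewrite ler10.
  have /andP[t0 t1] := t01.
  move=> H; exfalso; move: H; apply/negP; rewrite -ltNge /E lt_min.
  by do 2?case: ifP => _; rewrite ?t0 ?ltr01 ?subr_gt0 ?t1.
- have /andP[t0_gt0 t0_lt1] := t01; pose eps := Num.min t0 (1 - t0).
  have eps0 : 0 < eps by rewrite lt_min t0_gt0 subr_gt0.
  pose E e (t : R) :=
    Num.min (if `[< e = e0 >] then `|t - t0| else eps) eps.
  pose h p : R := match p with
    | Vertex u => eps
    | Inner e t => E e (val t) end.
  have hE e t : 0 <= t <= 1 -> h (edge_point e t) = E e t.
    move=> /andP[t_ge0 t1]; rewrite /edge_point; case: insubP => [u _ <-//|].
    have heps a : eps <= a -> eps = Num.min a eps by move=> ?; rewrite min_r.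
    rewrite negb_and -!leNgt => /orP[t_le0|t_ge1].
    - have -> : t = 0 by apply/eqP; rewrite eq_le t_le0.
      rewrite lexx /= /E; apply: heps; case: ifP => // _.
      by rewrite sub0r normrN gtr0_norm// ge_min lexx.
    - have -> : t = 1 by apply/eqP; rewrite eq_le t1.
      rewrite ler10 /= /E; apply: heps; case: ifP => // _.
      by rewrite gtr0_norm ?subr_gt0// ge_min lexx orbT.
  set p0 := Inner e0 _ in pq0 *.
  have : h q <= h p0 + path_dist p0 q.
    apply: path_dist_lipschitz => e s t s01 t01'; rewrite !hE//.
    apply: min_lipschitz; last by rewrite lerDl.
    case: ifP => _; last by rewrite lerDl.
    by rewrite [leRHS]addrC (distrC s) ler_distD.
  rewrite pq0 addr0 /= {1}/E.
  have -> : (if `[< e0 = e0 >] then `|t0 - t0| else eps) = 0.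
    by rewrite asboolT// subrr normr0.
  rewrite min_l ?(ltW eps0)//.
  case: q {pq0} => [u|e t] /=; first by rewrite leNgt eps0.
  rewrite /E ge_min [X in _ || X]leNgt eps0 orbF.
  case: asboolP => [->|_]; last by rewrite leNgt eps0.
  rewrite normr_le0 subr_eq0 => /eqP tt0.
  by congr Inner; apply: val_inj.
Qed.

HB.instance Definition _ := isMetric.Build R (realization R X)
  path_distxx path_dist_separated path_dist_sym path_dist_triangle.

End path_metric.

(** * Cayley graphs *)

Section cayley.
Context (G : groupType) (S : triangular_generating_set G).

(* The edge [(g, s)] joins [g] to [g s]. *)
Definition cayley_graph : graph :=
  @Graph G (G * seq_sub S)%type (fun x => x.1) (fun x => (x.1 * val x.2)%g).

Lemma cayley_connected (u v : vertex cayley_graph) : exists p, walk u p v.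
Proof.
have [/(_ (u^-1 * v)%g) [w uv] _] := triangular_presentation S.
have -> : v = (u * word_val (val : seq_sub S -> G) w)%g.
  by rewrite uv mulgA mulgV mul1g.
elim: w u {uv} => [|[s b] w IH] u /=; first by exists [::]; rewrite mulg1.
rewrite mulgA; case: b; rewrite /letter_val /=.
- have [p wp] := IH (u * (val s)^-1)%g.
  exists (((u * (val s)^-1)%g, s, true) :: p); split=> //.
  by rewrite /origin /= -mulgA mulVg mulg1.
- by have [p wp] := IH (u * val s)%g; exists ((u, s, false) :: p).
Qed.

Definition cayley : connected_graph := ConnectedGraph cayley_connected.

End cayley.

(** * Pseudocharacters *)

Definition expgz (G : groupType) (a : G) (n : int) : G :=
  match n with Posz k => (a ^+ k)%g | Negz k => (a ^- k.+1)%g end.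

Definition pseudocharacter (R : realType) (G : groupType) (f : G -> R) : Prop :=
  (forall (a : G) (n : int), f (expgz a n) = n%:~R * f a) /\
  exists C : R, forall a b : G, `|f a + f b - f (a * b)%g| <= C.

Section ends.
Context (R : realType) (G : groupType) (f : G -> R)
  (S : triangular_generating_set G).

Definition affine_extension (p : realization R (cayley S)) : R :=
  match p with
  | Vertex g => f g
  | Inner e t => (1 - val t) * f (source e) + val t * f (target e)
  end.

Local Notation F := affine_extension.

(* Maps defined on the half-line (or on [0, 1]) are represented by functions on
   [R] whose values outside of it are irrelevant. *)
Implicit Types phi : R -> realization R (cayley S).

Definition sigma phi : R :=
  if `[< F (phi t) @[t --> +oo] --> +oo >] then 1
  else if `[< F (phi t) @[t --> +oo] --> -oo >] then -1
  else 0.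

Definition equiv_at (C : R) phi1 phi2 : Prop :=
  sigma phi1 = sigma phi2 /\
  forall D : R, C < sigma phi1 * D ->
    exists delta : R -> realization R (cayley S),
      [/\ {within `[0, 1], continuous delta},
          (phi1 @` `[0, +oo[) (delta 0),
          (phi2 @` `[0, +oo[) (delta 1) &
          forall t, 0 <= t <= 1 -> `|F (delta t) - D| <= C].

Definition equiv phi1 phi2 : Prop :=
  exists2 C : R, 0 < C & equiv_at C phi1 phi2.

Definition rays : set (R -> realization R (cayley S)) :=
  [set phi : R -> realization R (cayley S) |
    {within `[0, +oo[, continuous phi} /\ (sigma phi = 1 \/ sigma phi = -1)].

Definition ends : set (set (R -> realization R (cayley S))) :=
  [set [set psi | rays psi /\ equiv phi psi] | phi in rays].

End ends.
Arguments rays {R G} f S _.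
Arguments ends {R G} f S _.

(* The cardinality of [ends f S] does not depend on [S]. *)
Definition uniform (R : realType) (G : groupType) (f : G -> R) : Prop :=
  forall S : triangular_generating_set G, (ends f S #= `I_2)%card.

(** * Quasi-actions *)

Section quasi_actions.
Context (R : realType).

Definition quasi_isometry (X Y : metricType R) (K C : R) (q : X -> Y) : Prop :=
  (forall x1 x2 : X, mdist x1 x2 / K - C <= mdist (q x1) (q x2)
                                         <= K * mdist x1 x2 + C) /\
  (forall y, exists x, mdist y (q x) <= C).

Definition quasi_action_with (G : groupType) (X : metricType R) (K C : R)
    (A : G -> X -> X) : Prop :=
  (forall g, quasi_isometry K C (A g)) /\
  (forall g h x, mdist (A g (A h x)) (A (g * h)%g x) <= C).

Definition quasi_action (G : groupType) (X : metricType R)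
    (A : G -> X -> X) : Prop :=
  exists K C : R, [/\ 1 <= K, 0 <= C & quasi_action_with K C A].

Definition cobounded (G : groupType) (X : metricType R)
    (A : G -> X -> X) : Prop :=
  forall x, exists D : R, forall y, exists g, mdist y (A g x) <= D.

End quasi_actions.

(** * Bushy spaces *)

Section bushy.
Context (R : realType) (X : metricType R).

Definition path_component (A : set X) (p : X) : set X :=
  [set q | exists gamma : R -> X,
    [/\ {within `[0, 1], continuous gamma}, gamma 0 = p, gamma 1 = q &
        gamma @` `[0, 1] `<=` A]].

Definition unbounded (A : set X) : Prop :=
  forall M : R, exists x y, [/\ A x, A y & M < mdist x y].

Definition bushy : Prop :=
  exists B : R, forall x : X,
    (`I_3 #<= [set C | [set path_component (~` ball x B) p
                         | p in ~` ball x B] C /\ unbounded C])%card.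

End bushy.

(* Main.v *)
From mathcomp Require Import all_boot all_order all_algebra.
From mathcomp Require Import all_classical all_reals all_analysis.
From mathcomp Require Import zify ring lra.
Require Import Defs.

(** The quasi-tree behind the theorem is the graph on [G] in which [x] and [y]
    are adjacent when a path of the Cayley graph joins them along which the
    pseudocharacter [f] is nearly constant ([flat]).  Adjacency only involves
    the values [f (z^-1 * w)], so [G] acts on this graph by honest isometries,
    and transitively on its vertices.

    Why it is a quasi-tree.  Cut the real line into long intervals and [G] into
    the components, in the Cayley graph, of the preimages of the intervals.
    Because the Cayley complex of a triangular presentation is simply connected,
    these components form a tree: counting the signed crossings between two
    neighbouring components is a cocycle, it vanishes on triangles, so it
    integrates to a function that separates the two sides
    ([cayley_separating]).  Hence any two points are joined by a path all of
    whose vertices are bottlenecks, that is, lie in components that every path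
    between the two points has to visit ([cayley_bottleneck]).  Each component
    has diameter at most one in the flat graph, so there every path between two
    points comes close to every vertex of the bottleneck path.  Consequently two
    points at the same distance [n] from the identity that can be joined outside
    the open ball of radius [n] are at bounded distance ([flat_thin]); a graph with
    this property is quasi-isometric to the tree of components of complements
    of balls about a base point ([level_tree]), and the isometric action turns
    into a cobounded quasi-action on that tree ([tree_quasi_action],
    [tree_cobounded]).

    Why the tree is bushy.  An element with nonzero [f]-value provides rays
    along which [f] tends to [+oo], and rays along which it tends to [-oo].
    Hence failure of uniformity means that, after possibly replacing [f] by
    [-f], two rays climbing to [+oo] are inequivalent
    ([nonuniform_inequivalent]).  Inequivalence says that there are two points
    [a] and [b] of about the same height such that every path from [a] to [b]
    that does not climb above that height descends very far
    ([inequivalent_rays_split]).  Let [z] be the lowest bottleneck between [a]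
    and [b].  A ball of bounded radius about [z] separates from one another the
    points [a], [b] and a point deep below [z]; the ascending rays based at [a]
    and [b] and the descending ray based at the third point stay far away from
    [z] ([flat_three_ended]).  Translating by [G] puts such a tripod at every
    vertex, so the complement of any ball of a suitable fixed radius has three
    unbounded components ([tree_bushy]). *)

Set Implicit Arguments.
Unset Strict Implicit.
Unset Printing Implicit Defensive.

Import Order.TTheory GRing.Theory Num.Theory.
Import numFieldNormedType.Exports.

Local Open Scope classical_set_scope.
Local Open Scope ring_scope.

(** * Paths and bottlenecks *)

Section joined.
Variables (V : Type) (E : V -> V -> Prop).
Implicit Types (P Q : V -> Prop) (x y z : V).

(** A path is recorded only through a set [P] of vertices on which it lives:
    concatenation, restriction and the statement that all paths meet a set are
    then immediate. *)
Inductive joined P x : V -> Prop :=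
| joined_refl : P x -> joined P x x
| joined_step y z : joined P x y -> E y z -> P z -> joined P x z.

Inductive steps x : nat -> V -> Prop :=
| steps_refl : steps x 0 x
| steps_step n y z : steps x n y -> E y z -> steps x n.+1 z.

Lemma joined_l P x y : joined P x y -> P x.
Proof. by elim. Qed.

Lemma joined_r P x y : joined P x y -> P y.
Proof. by case. Qed.

Lemma joined_sub P Q x y : (forall z, P z -> Q z) -> joined P x y -> joined Q x y.
Proof.
move=> PQ; elim=> [/PQ|y' z _ IH yz /PQ]; first exact: joined_refl.
exact: joined_step IH yz.
Qed.

Lemma joined_trans P y x z : joined P x y -> joined P y z -> joined P x z.
Proof. by move=> xy; elim=> // ? ? _; apply: joined_step. Qed.

Lemma joined_prefix P x y : joined P x y -> joined (joined P x) x y.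
Proof.
elim=> [Px|y' z xy IH yz Pz]; first by do 2 constructor.
by apply: (joined_step IH yz); apply: (joined_step xy yz).
Qed.

Lemma joined_steps P x y : joined P x y -> exists n, steps x n y.
Proof.
elim=> [_|y' z _ [n xy] yz _]; first by exists 0%N; left.
by exists n.+1; apply: (steps_step xy).
Qed.

Lemma steps_joined x n y : steps x n y ->
  joined (fun z => exists2 m, (m <= n)%N & steps x m z) x y.
Proof.
elim=> [|{}n y' z xy IH yz]; first by left; exists 0%N => //; left.
apply: (joined_step _ yz); last by exists n.+1 => //; apply: (steps_step xy).
by apply: joined_sub IH => w [m le_mn xw]; exists m => //; apply: leqW.
Qed.

Lemma steps_trans x n y m z : steps x n y -> steps y m z -> steps x (n + m) z.
Proof.
move=> xy; elim=> [|{}m u v _]; first by rewrite addn0.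
by move=> uv' uv; rewrite addnS; apply: (steps_step uv').
Qed.

Hypothesis E_sym : forall x y, E x y -> E y x.

Lemma joined_sym P x y : joined P x y -> joined P y x.
Proof.
elim=> [|y' z xy IH yz Pz]; first exact: joined_refl.
apply: (joined_trans _ IH).
exact: joined_step (joined_refl Pz) (E_sym yz) (joined_r xy).
Qed.

Lemma steps_sym x n y : steps x n y -> steps y n x.
Proof.
elim=> [|{}n y' z _ IH yz]; first exact: steps_refl.
rewrite -add1n; apply: (steps_trans _ IH).
exact: (steps_step (steps_refl z) (E_sym yz)).
Qed.

End joined.
Arguments joined_refl {V E P x}.
Arguments steps_refl {V E x}.

Lemma steps_fun (V : Type) (E : V -> V -> Prop) x n y : steps E x n y ->
  exists u : nat -> V, [/\ u 0%N = x, u n = y & forall i, (i < n)%N -> E (u i) (u i.+1)].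
Proof.
elim=> [|{}n y' z _ [u [u0 un uE]] yz]; first by exists (fun=> x).
exists (fun i => if (i <= n)%N then u i else z); split; rewrite ?ltnn//.
move=> i; rewrite ltnS => i_n; rewrite i_n; case: ltnP => [/uE//|n_i].
by have -> : i = n by [apply/eqP; rewrite eqn_leq i_n]; rewrite un.
Qed.

Lemma joined_bounded (R : realType) (V : Type) (E : V -> V -> Prop) (f : V -> R)
    x y : joined E (fun=> True) x y -> exists M, joined E (fun z => f z <= M) x y.
Proof.
elim=> [_|y' z _ [M IH] yz _]; first by exists (f x); left.
exists (Num.max M (f z)); apply: (joined_step _ yz); last by rewrite le_max lexx orbT.
by apply: joined_sub IH => w; move=> /le_trans; apply; rewrite le_max lexx.
Qed.

Section bottleneck.
Variables (V : Type) (E : V -> V -> Prop) (h : V -> int).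
Hypothesis E_sym : forall x y, E x y -> E y x.

(** The pieces into which the level sets of [h] cut the graph. *)
Definition same_comp x y := joined E (fun z => h z = h x) x y.

Lemma same_comp_h x y : same_comp x y -> h y = h x.
Proof. exact: joined_r. Qed.

Lemma same_comp_refl x : same_comp x x. Proof. exact: joined_refl. Qed.

Lemma same_comp_sym x y : same_comp x y -> same_comp y x.
Proof. by move=> xy; rewrite /same_comp (same_comp_h xy); apply: joined_sym. Qed.

Lemma same_comp_trans y x z : same_comp x y -> same_comp y z -> same_comp x z.
Proof. by rewrite /same_comp => xy; rewrite (same_comp_h xy); apply: joined_trans. Qed.

Lemma same_comp_edge x y : E x y -> h y = h x -> same_comp x y.
Proof. by move=> xy hxy; apply: (joined_step (joined_refl _) xy). Qed.

(** [u] is a cut vertex between [x] and [y] of the graph obtained by collapsing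
    every piece to a point. *)
Definition bottleneck x y u :=
  forall P, joined E P x y -> exists2 u', P u' & same_comp u u'.

Lemma bottleneck_sym x y u : bottleneck x y u -> bottleneck y x u.
Proof. by move=> b P yx; apply/b/joined_sym. Qed.

Lemma bottleneck_l x y : bottleneck x y x.
Proof. by move=> P xy; exists x; [exact: joined_l xy|exact: same_comp_refl]. Qed.

Lemma bottleneck_r x y : bottleneck x y y.
Proof. by move=> P xy; exists y; [exact: joined_r xy|exact: same_comp_refl]. Qed.

(** Every edge between distinct pieces is a bridge of the collapsed graph, which
    is therefore a tree; [e] tells the two sides of the bridge apart. *)
Hypothesis separating : forall y z, E y z -> h y <> h z ->
  exists2 e : V -> int, e y <> e z &
    forall u v, E u v -> e u <> e v ->
      (same_comp y u /\ same_comp z v) \/ (same_comp z u /\ same_comp y v).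

Let joined_same x y z :
  joined E (bottleneck x y) x y -> same_comp y z -> joined E (bottleneck x z) x z.
Proof.
move=> xy yz.
have bott u : bottleneck x y u -> bottleneck x z u.
  move=> b P xz.
  have [|u' [Pu'|yu'] uu'] := b (fun w => P w \/ same_comp y w).
  - apply: (joined_trans (y := z)); first by apply: joined_sub xz; left.
    by apply: (joined_sym E_sym); apply: joined_sub (joined_prefix yz); right.
  - by exists u'.
  - exists z; first exact: joined_r xz.
    by apply: (same_comp_trans uu'); apply: (same_comp_trans (same_comp_sym yu')); exact: yz.
apply: (joined_trans (joined_sub bott xy)).
have yz' : joined E (same_comp y) y z by apply: joined_prefix.
apply: joined_sub yz' => w yw P xz; exists z; first exact: joined_r xz.
exact: (same_comp_trans (same_comp_sym yw)).
Qed.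

(** In a tree the geodesic from [x] to [z] consists of cut vertices.  It is built
    by following any path from [x] to [z]: let [y] be the last vertex before [z].
    If [z] is a bottleneck between [x] and [y], then the path already met the
    piece of [z], and a shorter path can be used.  Otherwise some path avoids the
    piece of [z], so [y] lies on the same side as [x] of the bridge from [y] to
    [z]; every path to [z] then crosses that bridge, so the geodesic to [y] can
    be prolonged. *)
Theorem joined_bottleneck P x y :
  joined E P x y -> joined E (bottleneck x y) x y.
Proof.
move=> xy; have [n {xy}] := joined_steps xy.
elim/ltn_ind: n y => -[|n] IH z.
  by inversion 1; left; apply: bottleneck_l.
inversion 1 as [|n' y z' xy yz]; subst.
have {}H := IH n (ltnSn n) y xy.
have [hyz|hyz] := eqVneq (h y) (h z).
  by apply: (joined_same H); apply: same_comp_edge.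
have [bz|] := pselect (bottleneck x y z).
  have [z' [m le_mn xz'] zz'] := bz _ (steps_joined xy).
  by apply: (joined_same _ (same_comp_sym zz')); apply: IH xz'; rewrite ltnS.
move=> /existsNP[P0 /not_implyP[xy0 avoid]].
have [|e e_yz e_cut] := separating yz; first exact/eqP.
(* A path that avoids the piece of z cannot cross the bridge. *)
have e_xy : e y = e x.
  elim: xy0 avoid => // u v xu IHu uv Pv avoid.
  have -> : e v = e u.
    apply: contrapT => e_vu; apply: avoid.
    have [|[yu zv]|[zu yv]] := e_cut _ _ uv; first by move/esym.
    - by exists v.
    - by exists u => //; apply: joined_r xu.
  by apply: IHu => -[w Pw zw]; apply: avoid; exists w.
(* Reaching the other side of the bridge requires visiting the piece of y
   first. *)
have cross Q w : joined E Q x w -> e w <> e x ->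
    exists2 y', joined E Q x y' & same_comp y y'.
  elim=> // u v xu IHu uv Qv e_vx.
  have [e_ux|/eqP/IHu//] := eqVneq (e u) (e x).
  have [|[yu _]|[_ yv]] := e_cut _ _ uv; first by rewrite e_ux; apply/nesym.
  - by exists u.
  - by exists v => //; apply: (joined_step xu).
have {}cross Q : joined E Q x z -> exists2 y', joined E Q x y' & same_comp y y'.
  by move=> xz; apply: (cross _ _ xz); rewrite -e_xy; apply/nesym.
apply: (joined_step _ yz); last exact: bottleneck_r.
apply: joined_sub H => u bu Q xz; have [y' xy' yy'] := cross _ xz.
have [|u' [Qu'|yu'] uu'] := bu (fun w => Q w \/ same_comp y w).
- apply: (joined_trans (y := y')); first by apply: joined_sub xy'; left.
  by apply: (joined_sym E_sym); apply: joined_sub (joined_prefix yy'); right.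
- by exists u'.
- exists y'; first exact: joined_r xy'.
  by apply: (same_comp_trans uu'); apply: (same_comp_trans (same_comp_sym yu')); exact: yy'.
Qed.

End bottleneck.

(** * Simple connectedness of the Cayley complex *)

Local Arguments letter_val : simpl never.

Section cocycle.
Variables (G : groupType) (I : finType) (rho : I -> G) (rel : seq (word I)).
Hypothesis pres : presentation rho rel.
Variable c : G -> G -> int.
Hypothesis c_anti : forall x y, c y x = - c x y.

(** The integral of the cochain [c] along the path spelled by [w] from [x]. *)
Fixpoint word_sum (x : G) (w : word I) : int :=
  if w is l :: w' then
    c x (x * letter_val rho l)%g + word_sum (x * letter_val rho l)%g w'
  else 0.

Lemma word_val_cat u v : word_val rho (u ++ v) = (word_val rho u * word_val rho v)%g.
Proof. by elim: u => [|l u IH] /=; rewrite ?mul1g// IH mulgA. Qed.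

Lemma word_sum_cat x u v :
  word_sum x (u ++ v) = word_sum x u + word_sum (x * word_val rho u)%g v.
Proof.
elim: u x => [|l u IH] x /=; first by rewrite mulg1 add0r.
by rewrite IH addrA mulgA.
Qed.

Lemma letter_valV i b :
  (letter_val rho (i, b) * letter_val rho (i, ~~ b))%g = 1%g.
Proof. by case: b; rewrite /letter_val /= ?mulgV ?mulVg. Qed.

Hypothesis c_rel : forall x r, r \in rel -> word_sum x r = 0.

Lemma word_sum_eq u v : word_eq rel u v ->
  word_val rho u = word_val rho v /\ forall x, word_sum x u = word_sum x v.
Proof.
elim=> {u v} [//|u v _ [-> uv]|u v w _ [-> uv] _ [-> vw]|u i b v|u r v rr].
- by split=> // x; rewrite uv.
- by split=> // x; rewrite uv vw.
- split=> [|x].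
    rewrite !word_val_cat /= [(letter_val _ _ * _)%g]mulgA.
    by rewrite letter_valV mul1g.
  rewrite !word_sum_cat /= -!mulgA letter_valV mulg1 mulgA.
  rewrite -mulgA; set y := (x * _)%g; set z := (x * (_ * _))%g.
  by rewrite (c_anti y z) [_ + (- _ + _)]addrA subrr add0r.
- have r1 : word_val rho r = 1%g.
    apply/pres.2; have := word_eq_relator [::] [::] rr.
    by rewrite cats0.
  split=> [|x]; first by rewrite !word_val_cat r1 mul1g.
  by rewrite !word_sum_cat r1 mulg1 (c_rel _ rr) add0r.
Qed.

(** Both words are completed to closed paths by the same word [t]. *)
Lemma word_sum_closed x u v :
  word_val rho u = word_val rho v -> word_sum x u = word_sum x v.
Proof.
move=> uv; have [t tE] := pres.1 (word_val rho u)^-1%g.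
have closed w : word_val rho w = word_val rho u ->
    word_sum x w + word_sum (x * word_val rho u)%g t = 0.
  move=> wu; have /pres.2/word_sum_eq[_ /(_ x)] : word_val rho (w ++ t) = 1%g.
    by rewrite word_val_cat wu tE mulgV.
  by rewrite word_sum_cat wu.
by apply: (addIr (word_sum (x * word_val rho u)%g t)); rewrite !closed.
Qed.

(** The first cohomology of the Cayley complex vanishes: [e x] is the integral of
    [c] along a path from the identity to [x], computed as minus the integral
    back from [x]. *)
Lemma cocycle_potential : exists e : G -> int,
  forall x i, e (x * rho i)%g - e x = c x (x * rho i)%g.
Proof.
have [w wE] := choice (fun x : G => pres.1 x^-1%g).
exists (fun x => - word_sum x (w x)) => x i.
have -> : word_sum x (w x) = word_sum x ((i, false) :: w (x * rho i)%g).
  apply: word_sum_closed; rewrite /= !wE /letter_val /=.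
  by rewrite invgM mulgA mulgV mul1g.
by rewrite /= /letter_val /= opprK addrC addrK.
Qed.

End cocycle.

Section cayley_separation.
Variables (G : groupType) (S : triangular_generating_set G).

Definition adj (x y : G) : Prop :=
  exists s : seq_sub S, y = (x * val s)%g \/ x = (y * val s)%g.

Lemma adj_sym x y : adj x y -> adj y x.
Proof. by move=> [s [E|E]]; exists s; [right|left]. Qed.

Lemma adj_mull g x y : adj x y -> adj (g * x)%g (g * y)%g.
Proof. by move=> [s [->|->]]; exists s; rewrite mulgA; [left|right]. Qed.

Lemma adj_letter x (l : seq_sub S * bool) :
  adj x (x * letter_val (val : seq_sub S -> G) l)%g.
Proof.
case: l => s [|]; exists s; rewrite /letter_val /=; last by left.
by right; rewrite mulgVK.
Qed.

Lemma adj_connected x y : joined adj (fun=> True) x y.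
Proof.
have [/(_ (x^-1 * y)%g)[w wE] _] := triangular_presentation S.
have -> : y = (x * word_val (val : seq_sub S -> G) w)%g.
  by rewrite wE mulgA mulgV mul1g.
elim: w x {wE} => [|l w IH] x /=; first by rewrite mulg1; left.
rewrite mulgA; apply: joined_trans (IH _).
by apply: (joined_step (joined_refl _) (adj_letter x l)).
Qed.

Variable h : G -> int.
Hypothesis hE : forall x y, adj x y -> `|h x - h y| <= 1.

(** The signed number [c] of crossings from the piece of [y] to the piece of [z]
    is a cocycle.  The heights of the three vertices of a triangle differ by at
    most one, so a triangle with an edge between the two pieces has its third
    vertex in one of them, and it crosses between them once in each direction.
    The potential of [c] tells the two sides apart. *)
Lemma cayley_separating y z : adj y z -> h y <> h z ->
  exists2 e : G -> int, e y <> e z &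
    forall u v, adj u v -> e u <> e v ->
      (same_comp adj h y u /\ same_comp adj h z v) \/
      (same_comp adj h z u /\ same_comp adj h y v).
Proof.
move=> yz hyz.
pose A u := `[< same_comp adj h y u >]; pose B u := `[< same_comp adj h z u >].
pose c u v : int := (A u && B v)%:Z - (B u && A v)%:Z.
have hA u : A u -> h u = h y by move=> /asboolW; apply: same_comp_h.
have hB u : B u -> h u = h z by move=> /asboolW; apply: same_comp_h.
have closeA u v : adj u v -> A u -> h v = h y -> A v.
  move=> uv Au hv; apply/asboolP; apply: (same_comp_trans (asboolW Au)).
  by apply: same_comp_edge => //; rewrite hv hA.
have closeB u v : adj u v -> B u -> h v = h z -> B v.
  move=> uv Bu hv; apply/asboolP; apply: (same_comp_trans (asboolW Bu)).
  by apply: same_comp_edge => //; rewrite hv hB.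
have c_anti u v : c v u = - c u v.
  by rewrite /c opprB (andbC (A v)) (andbC (B v)).
have triangle u v w : adj u v -> adj v w -> adj w u ->
    c u v + c v w + c w u = 0.
  move=> uv vw wu.
  have := hA u; have := hA v; have := hA w.
  have := hB u; have := hB v; have := hB w.
  have := closeA _ _ uv; have := closeA _ _ vw; have := closeA _ _ wu.
  have := closeB _ _ uv; have := closeB _ _ vw; have := closeB _ _ wu.
  have := closeA _ _ (adj_sym uv); have := closeA _ _ (adj_sym vw).
  have := closeA _ _ (adj_sym wu).
  have := closeB _ _ (adj_sym uv); have := closeB _ _ (adj_sym vw).
  have := closeB _ _ (adj_sym wu).
  have := hE uv; have := hE vw; have := hE wu; have := hE yz.
  rewrite /c; case: (A u); case: (A v); case: (A w);
  case: (B u); case: (B v); case: (B w) => //=; lia.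
have [|e eE] := cocycle_potential (triangular_presentation S) c_anti.
  move=> x r rr; have := triangular_relators rr.
  have r1 : word_val (val : seq_sub S -> G) r = 1%g.
    apply/(triangular_presentation S).2.
    by have := word_eq_relator [::] [::] rr; rewrite cats0.
  case: r {rr} r1 => [|l1 [|l2 [|l3 []]]] //= r1 _.
  have xE : (x * letter_val val l1 * letter_val val l2 * letter_val val l3)%g = x.
    by rewrite -!mulgA; move: r1; rewrite mulg1 => ->; rewrite mulg1.
  rewrite xE addr0 addrA triangle//; try exact: adj_letter.
  by rewrite -{2}xE; apply: adj_letter.
have eE' u v : adj u v -> e v - e u = c u v.
  by move=> [s [->//|->]]; rewrite c_anti -eE opprB.
exists e => [eyz|u v uv].
  have : c y z = 1.
    have Ay : A y by apply/asboolP/same_comp_refl.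
    have Bz : B z by apply/asboolP/same_comp_refl.
    have nAz : ~~ A z by apply/negP => /hA /esym.
    by rewrite /c Ay Bz (negbTE nAz) andbF.
  by rewrite -eE'// eyz subrr.
have := eE' _ _ uv; rewrite /c => euv e_neq.
have [/andP[/asboolW ? /asboolW ?]|nAB] := boolP (A u && B v); first by left.
have [/andP[/asboolW ? /asboolW ?]|nBA] := boolP (B u && A v); first by right.
by exfalso; apply: e_neq; move: euv; rewrite (negbTE nAB) (negbTE nBA); lia.
Qed.

Lemma cayley_bottleneck x y :
  joined adj (bottleneck adj h x y) x y.
Proof.
exact: (joined_bottleneck adj_sym cayley_separating (adj_connected x y)).
Qed.

End cayley_separation.

(** * Graph distance and the tree of complements of balls *)

Section graph_distance.
Local Open Scope nat_scope.
Variables (V : Type) (E : V -> V -> Prop).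
Hypothesis E_sym : forall x y, E x y -> E y x.
Hypothesis E_conn : forall x y, joined E (fun=> True) x y.

Let gdist_ex x y : exists n, `[< steps E x n y >].
Proof. by have [n xy] := joined_steps (E_conn x y); exists n; apply/asboolP. Qed.

Definition gdist x y : nat := ex_minn (gdist_ex x y).

Lemma gdist_steps x y : steps E x (gdist x y) y.
Proof. by rewrite /gdist; case: ex_minnP => n /asboolW. Qed.

Lemma gdist_le x y n : steps E x n y -> gdist x y <= n.
Proof. by rewrite /gdist; case: ex_minnP => m _ + xy; apply; apply/asboolP. Qed.

Lemma gdist_lipschitz (R : realType) (h : V -> R) (c : R) x y :
  (forall u v, E u v -> `|h u - h v| <= c)%R ->
  (`|h x - h y| <= c * (gdist x y)%:R)%R.
Proof.
move=> hc; have := gdist_steps x y; move: (gdist x y) => n.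
elim=> [|{}n u z _ IH /hc uz]; first by rewrite subrr normr0 mulr0.
rewrite -natr1 mulrDr mulr1 (le_trans _ (lerD IH uz))//.
by rewrite (le_trans _ (ler_normD _ _))// addrA subrK.
Qed.

Lemma gdistxx x : gdist x x = 0.
Proof. by apply/eqP; rewrite -leqn0; apply: gdist_le; left. Qed.

Lemma gdistC x y : gdist x y = gdist y x.
Proof.
by apply/eqP; rewrite eqn_leq; apply/andP; split;
  apply/gdist_le/(steps_sym E_sym)/gdist_steps.
Qed.

Lemma gdist_triangle y x z : gdist x z <= gdist x y + gdist y z.
Proof. by apply: gdist_le; apply: steps_trans (gdist_steps _ _) (gdist_steps _ _). Qed.

Lemma gdist_edge x y : E x y -> gdist x y <= 1.
Proof. by move=> xy; apply: gdist_le; apply: (steps_step (steps_refl) xy). Qed.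

Lemma gdist_eq0 x y : gdist x y = 0 -> x = y.
Proof. by move=> xy0; have := gdist_steps x y; rewrite xy0; inversion 1. Qed.

Lemma gdist_pred o x n : gdist o x = n.+1 -> exists2 y, E y x & gdist o y = n.
Proof.
move=> ox; have := gdist_steps o x; rewrite ox.
inversion 1 as [|n' y z oy yx]; subst; exists y => //.
apply/eqP; rewrite eqn_leq gdist_le//= -ltnS -ox.
by rewrite -addn1 (leq_trans (gdist_triangle y _ _))// leq_add2l gdist_edge.
Qed.

Lemma gdist_geodesic x y :
  joined E (fun z => gdist x z + gdist z y = gdist x y) x y.
Proof.
have [n xy] : exists n, gdist x y = n by exists (gdist x y).
elim: n y xy => [|n IH] y xy; rewrite xy.
  by rewrite -(gdist_eq0 xy); left; rewrite gdistxx.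
have [z zy xz] := gdist_pred xy.
apply: (joined_step _ zy); last by rewrite gdistxx xy addn0.
apply: joined_sub (IH z xz) => w; rewrite xz => xwz.
apply/eqP; rewrite eqn_leq -{2}xy gdist_triangle andbT -xwz -addn1 -addnA leq_add2l.
by rewrite (leq_trans (gdist_triangle z _ _))// leq_add2l gdist_edge.
Qed.

Lemma joined_near x y : joined E (fun z => gdist x z <= gdist x y) x y.
Proof. by apply: joined_sub (gdist_geodesic x y) => z <-; apply: leq_addr. Qed.

End graph_distance.

Section walks.
Variable X : graph.

Lemma walk_cat (u v : vertex X) p q :
  walk u (p ++ q) v <-> exists2 w, walk u p w & walk w q v.
Proof.
elim: p u => [|x p IH] u /=; first by split=> [|[w ->]//]; exists u.
split=> [[<- /IH[w]]|[w [<- xw] wv]]; first by exists w.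
by split=> //; apply/IH; exists w.
Qed.

Lemma reduced_infix (p q r : seq (edge X * bool)) :
  reduced (p ++ q ++ r) -> reduced q.
Proof.
move=> red p1 e b p2 qE; apply: (red (p ++ p1) e b (p2 ++ r)).
by rewrite qE -!catA.
Qed.

End walks.

Section level_tree.
Local Open Scope nat_scope.
Variables (V : choiceType) (E : V -> V -> Prop) (o : V).
Hypothesis E_sym : forall x y, E x y -> E y x.
Hypothesis E_conn : forall x y, joined E (fun=> True) x y.
Local Notation d := (gdist E_conn).
Local Notation len := (d o).

(** [x] and [y] lie on one sphere about [o] and in one component of the
    complement of the open ball that it bounds. *)
Definition linked x y := len x = len y /\ joined E (fun z => len x <= len z) x y.

Lemma linked_refl x : linked x x. Proof. by split=> //; left. Qed.

Lemma linked_sym x y : linked x y -> linked y x.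
Proof. by move=> [xy xEy]; split=> //; rewrite -xy; apply: joined_sym. Qed.

Lemma linked_trans y x z : linked x y -> linked y z -> linked x z.
Proof.
rewrite /linked => -[<- xEy] [xz yEz]; split=> //; exact: joined_trans yEz.
Qed.

Definition parents x : set V :=
  [set y | exists2 x', linked x x' & E y x' /\ (len y).+1 = len x].

(** The set of candidates depends only on the class of [x], so linked vertices
    have equal parents. *)
Definition parent x : V := xget o (parents x).

Lemma linked_parent x y : linked x y -> parent x = parent y.
Proof.
move=> xy; rewrite /parent; congr xget; apply/seteqP; split=> z [w xw []].
- rewrite xy.1 => zw lz; exists w => //; exact: linked_trans (linked_sym xy) xw.
- rewrite -xy.1 => zw lz; exists w => //; exact: linked_trans xw.
Qed.

Lemma parentP x : len x != 0 -> parents x (parent x).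
Proof.
case lx: (len x) => [//|n] _; apply: xgetPex.
have [y yx ly] := gdist_pred lx; exists y; exists x; first exact: linked_refl.
by rewrite ly lx.
Qed.

Lemma len_parent x : len x != 0 -> (len (parent x)).+1 = len x.
Proof. by move=> /parentP[x' _ []]. Qed.

(** Up to linking the choice of the parent does not matter: two candidates are
    joined through the class of [x], one level farther out. *)
Lemma linked_predecessor x y : E y x -> (len y).+1 = len x -> linked y (parent x).
Proof.
move=> yx lyx; have [|x' [lxx' xEx'] [px' lp]] := @parentP x; first by rewrite -lyx.
have lyp : len y = len (parent x) by apply/succn_inj; rewrite lyx lp.
split=> //; apply: (joined_step _ (E_sym px')); last by rewrite lyp.
apply: (@joined_trans _ _ _ x).
  by apply: (joined_step (joined_refl _) yx) => //; rewrite -lyx.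
by apply: joined_sub xEx' => z; rewrite -lyx; apply: ltnW.
Qed.

(** All of [V] serves as vertex set, the vertices of one class being leaves or
    branches that hang from the same parent: compared with the tree of classes
    this changes distances by a bounded amount only. *)
Definition level_graph : graph :=
  @Graph V {x : V | len x != 0} (fun e => val e) (fun e => parent (val e)).

Lemma level_connected (u v : vertex level_graph) : exists p, walk u p v.
Proof.
have root w : (exists p, @walk level_graph w p o) /\
              (exists p, @walk level_graph o p w).
  have [n lw] : exists n, len w = n by exists (len w).
  elim: n w lw => [w lw|n IH w lw].
    by rewrite -(gdist_eq0 lw); split; exists [::].
  have w0 : len w != 0 by rewrite lw.
  have lpw : len (parent w) = n := succn_inj (etrans (len_parent w0) lw).
  have [[p wp] [q wq]] := IH _ lpw.
  split; first by exists ((exist _ w w0, false) :: p).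
  by exists (q ++ [:: (exist _ w w0, true)]); apply/walk_cat; exists (parent w).
have [[p up] _] := root u; have [_ [q qv]] := root v.
by exists (p ++ q); apply/walk_cat; exists o.
Qed.

Definition level_tree : connected_graph := ConnectedGraph level_connected.

Let ups (s : seq (edge level_tree)) := [seq (e, false) | e <- s].
Let downs (s : seq (edge level_tree)) := [seq (e, true) | e <- s].

(** After descending an edge, the only way up is that same edge: a reduced path
    that has begun to descend never climbs again. *)
Let reduced_updown (u v : vertex level_tree) p : walk u p v -> reduced p ->
  exists s1 s2, p = ups s1 ++ downs s2.
Proof.
elim: p u => [|[e b] p IH] u /=; first by exists [::], [::].
move=> [_ wp] red.
have [|s1 [s2 pE]] := IH _ wp.
  by apply: (@reduced_infix _ [:: (e, b)] _ [::]); rewrite cats0.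
case: b wp red => [|_ _]; last by exists (e :: s1), s2; rewrite pE.
case: s1 pE => [|e' s1] pE; first by exists [::], (e :: s2); rewrite pE.
rewrite pE => -[/val_inj/= ee' _] red; case: (red [::] e true (ups s1 ++ downs s2)).
by rewrite /= ee'.
Qed.

Let len_ups (u v : vertex level_tree) s :
  walk u (ups s) v -> len u = len v + size s.
Proof.
elim: s u => [|e s IH] u /=; first by move=> ->; rewrite addn0.
move=> [<- /IH eE]; rewrite addnS -eE; apply: esym.
exact: (len_parent (valP e)).
Qed.

Let len_downs (u v : vertex level_tree) s :
  walk u (downs s) v -> len v = len u + size s.
Proof.
elim: s u => [|e s IH] u /=; first by move=> ->; rewrite addn0.
move=> [<- /IH ->]; rewrite addnS -addSn; congr (_ + _); apply: esym.
exact: (len_parent (valP e)).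
Qed.

(** In a closed path the first edge up and the last edge down both have the base
    point as source, hence coincide; what lies between them is a shorter closed
    path. *)
Let updown_nil (v : vertex level_tree) s1 s2 :
  walk v (ups s1 ++ downs s2) v -> reduced (ups s1 ++ downs s2) ->
  s1 = [::] /\ s2 = [::].
Proof.
elim: s1 s2 v => [|e s1 IH] s2 v.
  move=> /len_downs/eqP; rewrite -{1}[len v]addn0 eqn_add2l.
  by case: s2.
move=> /walk_cat[w vw wv] red.
have s12 : (size s1).+1 = size s2.
  exact: (addnI (etrans (esym (len_ups vw)) (len_downs wv))).
case/lastP: s2 s12 wv red => [//|s2 e'] _ wv red.
have ve : val e = v by case: vw.
move: wv; rewrite /downs map_rcons -cats1 => /walk_cat[w' ww' [w'e' ve']].
have ee' : e = e' by apply: val_inj; rewrite ve.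
have pE : ups (e :: s1) ++ downs (rcons s2 e') =
    [:: (e, false)] ++ (ups s1 ++ downs s2) ++ [:: (e', true)].
  by rewrite /downs map_rcons -cats1 -catA.
rewrite pE in red.
have [||s10 s20] := IH s2 (parent v); last first.
- by case: (red [::] e false [::]); rewrite s10 s20 ee'.
- exact: reduced_infix red.
- apply/walk_cat; exists w; first by case: vw => _; rewrite -ve.
  by move: w'e'; rewrite /origin /= -ee' ve => ->.
Qed.

Lemma level_treeP : tree level_tree.
Proof.
split=> [|v p vp red]; first exact: (inhabits o).
have [s1 [s2 pE]] := reduced_updown vp red.
by move: vp red; rewrite pE => vp /(updown_nil vp)[-> ->].
Qed.

End level_tree.

(** * Lipschitz paths in metric spaces *)

Section metric_paths.
Variables (R : realType) (Y : metricType R).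

Lemma lipschitz_continuous (k : R) (g : R -> Y) :
  (forall s t, mdist (g s) (g t) <= k * `|s - t|) -> continuous g.
Proof.
move=> gk t; have [k0|k0] := lerP k 0.
  have gt s : g s = g t.
    apply/mdist_positivity/eqP; rewrite eq_le mdist_ge0 andbT.
    by rewrite (le_trans (gk _ _))// mulr_le0_ge0.
  by rewrite (_ : g = cst (g t)); [exact: cvg_cst|apply/funext].
apply/metricType_numDomainType.cvgrPdist_lt => eps eps0; near=> s.
rewrite (le_lt_trans (gk _ _))// mulrC -ltr_pdivlMr//.
by near: s; apply: cvgr_dist_lt => //; rewrite divr_gt0.
Unshelve. all: by end_near. Qed.

Lemma within_continuous_mdist (A : set R) (g : R -> Y) t r :
  {within A, continuous g} -> A t -> 0 < r ->
  exists2 eps, 0 < eps & forall s, A s -> `|s - t| < eps -> mdist (g t) (g s) < r.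
Proof.
move=> /subspace_continuousP gc At r0.
have /metricType_numDomainType.cvgrPdist_lt/(_ r r0) := gc t At.
move=> /nbhs_ballP[eps /= eps0 geps]; exists eps => // s As st.
by apply: geps => //; rewrite /ball /= distrC.
Qed.

(** The interval is connected: a predicate that is locally constant on it is
    constant. *)
Lemma clopen_induction (A : R -> Prop) (T : R) : 0 <= T -> A 0 ->
  (forall t, 0 <= t <= T -> exists2 eps, 0 < eps &
    forall s, 0 <= s <= T -> `|s - t| < eps -> A s <-> A t) ->
  A T.
Proof.
move=> T0 A0 loc; pose C := [set t | 0 <= t <= T /\ forall s, 0 <= s <= t -> A s].
have C0 : C 0.
  split=> [|s]; first by rewrite lexx.
  by rewrite -eq_le => /eqP <-.
have CT : ubound C T by move=> t [/andP[]].
have hsC : has_sup C by split; [exists 0|exists T].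
have c0 : 0 <= sup C by apply: ub_le_sup => //; exists T.
have cT : sup C <= T by apply: ge_sup => //; exists 0.
have [|eps eps0 near_c] := loc (sup C); first by rewrite c0.
have [t [/andP[t0 tT] At] t_gt] := sup_adherent eps0 hsC.
have tc : t <= sup C by apply: ub_le_sup; [exists T|split; [rewrite t0|]].
have Ac : A (sup C).
  apply/(near_c t); first by rewrite t0.
    by rewrite ltr_distl; apply/andP; split; lra.
  by apply: At; rewrite t0 /=.
have [<-//|cT'] := eqVneq (sup C) T.
have {}cT' : sup C < T by rewrite lt_neqAle cT'.
pose u := Num.min T (sup C + eps / 2).
have cu : sup C < u by rewrite lt_min cT' ltrDl divr_gt0.
suff : u <= sup C by rewrite leNgt cu.
apply: ub_le_sup; first by exists T.
have uT : u <= T by rewrite ge_min lexx.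
have ue : u <= sup C + eps / 2 by rewrite ge_min lexx orbT.
split=> [|s /andP[s0 su]]; first by rewrite uT andbT; lra.
have [st|ts] := lerP s t; first by apply: At; rewrite s0.
apply/near_c => //; first by rewrite s0 /=; lra.
by rewrite ltr_distl; apply/andP; split; lra.
Qed.

(** The paths [g 0], [g 1], ... are run through one after the other, and [phi] is
    constant before time [0], which makes it Lipschitz on the whole line.  It
    yields rays, and finite concatenations by making [g n] eventually constant. *)
Lemma lipschitz_concatenation (k : R) (g : nat -> R -> Y) : 0 <= k ->
  (forall n s t, 0 <= s <= 1 -> 0 <= t <= 1 ->
    mdist (g n s) (g n t) <= k * `|s - t|) ->
  (forall n, g n 1 = g n.+1 0) ->
  exists phi : R -> Y,
    [/\ forall s t, mdist (phi s) (phi t) <= k * `|s - t|,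
        forall n s, 0 <= s <= 1 -> phi (n%:R + s) = g n s &
        forall t, exists n s, 0 <= s <= 1 /\ phi t = g n s].
Proof.
move=> k0 gL gE.
pose phi t := let u := Num.max 0 t in
  g (Num.trunc u) (u - (Num.trunc u)%:R).
have phiE n s : 0 <= s <= 1 -> phi (n%:R + s) = g n s.
  move=> /andP[s0 s1].
  have -> : phi (n%:R + s) =
      g (Num.trunc (n%:R + s)) (n%:R + s - (Num.trunc (n%:R + s))%:R).
    by rewrite /phi max_r// addr_ge0.
  move: s1; rewrite le_eqVlt => /orP[/eqP->|s1].
    by rewrite (@truncn_def _ _ n.+1) ?gE -?natr1 ?subrr// lexx ltrDl ltr01.
  by rewrite (@truncn_def _ _ n) -?natr1 ?lerDl ?s0 ?ltrD2l// addrAC subrr add0r.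
have decomp t : 0 <= t -> exists n s, [/\ 0 <= s <= 1, t = n%:R + s & phi t = g n s].
  move=> t0; have /andP[] := truncn_itv t0; set n := Num.trunc t => nt tn.
  exists n, (t - n%:R); have s01 : 0 <= t - n%:R <= 1.
    by rewrite subr_ge0 nt lerBlDl natr1 ltW.
  by split=> //; [rewrite addrC subrK|rewrite -phiE// addrC subrK].
have phi_neg t : t <= 0 -> phi t = phi 0 by move=> t0; rewrite /phi (max_l t0) maxxx.
(* Induction on the number j of integers between the two times. *)
have chain j n a b : 0 <= a <= 1 -> 0 <= b <= 1 ->
    mdist (phi (n%:R + a)) (phi ((n + j)%:R + b)) <=
      k * `|n%:R + a - ((n + j)%:R + b)|.
  elim: j n a => [|j IH] n a a01 b01.
    by rewrite addn0 !phiE// opprD addrACA subrr add0r gL.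
  apply: (le_trans (metric_triangle _ (phi (n%:R + 1)) _)).
  have i1 : 0 <= (1 : R) <= 1 by rewrite ler01 lexx.
  have i0 : 0 <= (0 : R) <= 1 by rewrite ler01 lexx.
  have := IH n.+1 0 i0 b01; rewrite addSnnS addr0 => IH'.
  have step : mdist (phi (n%:R + a)) (phi (n%:R + 1)) <= k * `|a - 1|.
    by rewrite !phiE//; exact: gL.
  rewrite -natr1 in IH'; apply: (le_trans (lerD step IH')).
  rewrite natrD -[j.+1%:R]natr1.
  have j0 : 0 <= j%:R :> R by [].
  have /andP[a0 a1] := a01; have /andP[b0 b1] := b01.
  rewrite -mulrDr ler_wpM2l// !ler0_norm; lra.
have phiL s t : 0 <= s -> s <= t -> mdist (phi s) (phi t) <= k * `|s - t|.
  move=> s0 st; have t0 := le_trans s0 st.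
  have [n [a [a01 sE _]]] := decomp s s0; have [m [b [b01 tE _]]] := decomp t t0.
  have [nm|mn] := leqP n m.
    by rewrite sE tE -(subnKC nm) chain.
  have nm1 : m.+1%:R <= n%:R :> R by rewrite ler_nat.
  have {}st : s = t.
    by apply/eqP; rewrite eq_le st sE tE; move: nm1; rewrite -natr1; lra.
  by rewrite st mdistxx mulr_ge0.
have phiL0 s t : 0 <= s -> 0 <= t -> mdist (phi s) (phi t) <= k * `|s - t|.
  move=> s0 t0; case/orP: (le_total s t) => [st|ts]; first exact: phiL.
  by rewrite metric_sym distrC phiL.
exists phi; split=> //.
- move=> s t; have [s0|/ltW s0] := lerP 0 s; have [t0|/ltW t0] := lerP 0 t.
  + exact: phiL0.
  + rewrite (phi_neg t)//; apply: (le_trans (phiL0 _ _ s0 (lexx _))).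
    by rewrite ler_wpM2l// !ger0_norm; lra.
  + rewrite (phi_neg s)//; apply: (le_trans (phiL0 _ _ (lexx _) t0)).
    by rewrite ler_wpM2l// !ler0_norm; lra.
  + by rewrite (phi_neg s)// (phi_neg t)// mdistxx mulr_ge0.
- move=> t; have [t0|/ltW t0] := lerP 0 t.
    by have [n [s [s01 _ tE]]] := decomp t t0; exists n, s.
  exists 0%N, 0; rewrite ler01 lexx; split=> //.
  by rewrite phi_neg// -phiE ?ler01 ?lexx// addr0.
Qed.

(** Unlike continuity on the unit interval, a global Lipschitz bound is preserved by
    concatenation without any gluing of topologies. *)
Definition lipschitz_path (A : set Y) (p q : Y) : Prop :=
  exists (k : R) (g : R -> Y),
    [/\ 0 <= k, forall s t, mdist (g s) (g t) <= k * `|s - t|,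
        g 0 = p, g 1 = q & forall t, 0 <= t <= 1 -> A (g t)].

Lemma lipschitz_pathP (A : set Y) p q :
  lipschitz_path A p q -> path_component A p q.
Proof.
move=> [k [g [_ gk g0 g1 gA]]]; exists g; split=> //.
  exact/continuous_subspaceT/lipschitz_continuous/gk.
by move=> _ [t /= t01 <-]; apply: gA; rewrite in_itv in t01.
Qed.

Lemma lipschitz_path_refl (A : set Y) p : A p -> lipschitz_path A p p.
Proof. by move=> Ap; exists 0, (fun=> p); split=> // s t; rewrite mdistxx mul0r. Qed.

Lemma lipschitz_path_sym (A : set Y) p q :
  lipschitz_path A p q -> lipschitz_path A q p.
Proof.
move=> [k [g [k0 gk g0 g1 gA]]]; exists k, (fun t => g (1 - t)); split=> //.
- by move=> s t; rewrite (le_trans (gk _ _))// opprB addrC subrKA distrC.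
- by rewrite subr0.
- by rewrite subrr.
- by move=> t /andP[t0 t1]; apply: gA; apply/andP; split; lra.
Qed.

Lemma lipschitz_path_trans (A : set Y) q p r :
  lipschitz_path A p q -> lipschitz_path A q r -> lipschitz_path A p r.
Proof.
move=> [k1 [g1 [k1_ge0 g1k g10 g11 g1A]]] [k2 [g2 [k2_ge0 g2k g20 g21 g2A]]].
pose k := k1 + k2; have k0 : 0 <= k by rewrite addr_ge0.
pose g n := match n with 0%N => g1 | 1%N => g2 | _ => fun=> r end.
have i1 : 0 <= (1 : R) <= 1 by rewrite ler01 lexx.
have i0 : 0 <= (0 : R) <= 1 by rewrite ler01 lexx.
have Ar : A r by rewrite -g21; apply: g2A.
have [||phi [phik phiE phig]] := @lipschitz_concatenation k g k0.
- move=> [|[|n]] s t _ _ /=; last by rewrite mdistxx mulr_ge0.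
  + by rewrite (le_trans (g1k _ _))// ler_wpM2r// lerDl.
  + by rewrite (le_trans (g2k _ _))// ler_wpM2r// lerDr.
- by move=> [|[|n]] /=; rewrite ?g11 ?g20 ?g21.
exists (k * 2), (fun t => phi (t * 2)); split=> //.
- by rewrite mulr_ge0.
- move=> s t; rewrite -mulrA; apply: (le_trans (phik _ _)).
  by rewrite -mulrBl normrM (@ger0_norm _ 2)// [2 * _]mulrC.
- by rewrite mul0r -[0]add0r (phiE 0%N).
- by rewrite mul1r (_ : 2 = 1%:R + 1)// (phiE 1%N).
- move=> t _; have [n [s [s01 ->]]] := phig (t * 2).
  by case: n => [|[|n]] /=; [exact: g1A|exact: g2A|].
Qed.

End metric_paths.

(** * Metric graphs *)

Section realization.
Variables (R : realType) (X : connected_graph).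
Local Notation Y := (realization R X).
Implicit Types (p q : Y) (u v : vertex X) (e : edge X).

Definition nearest p : vertex X :=
  match p with Vertex v => v | Inner e _ => source e end.

Lemma mdist_edge_point e (s t : R) :
  mdist (edge_point e s : Y) (edge_point e t) <= `|s - t|.
Proof.
pose clamp (s : R) := Num.min 1 (Num.max 0 s).
have clampE (x : R) : edge_point e x = edge_point e (clamp x).
  rewrite /clamp; case: (lerP x 0) => [x0|x0].
    rewrite min_r ?ler01// edge_point0 /edge_point x0.
    by case: insubP => // u; rewrite ltNge x0.
  case: (lerP 1 x) => [x1|//]; rewrite edge_point1 /edge_point leNgt x0 /=.
  by case: insubP => // u; rewrite [_ < 1]ltNge x1 andbF.
have clamp01 x : 0 <= clamp x <= 1.
  by rewrite /clamp ge_min lexx le_min ler01 le_max lexx.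
rewrite (clampE s) (clampE t); apply: (@le_trans _ _ `|clamp s - clamp t|).
  by apply: path_dist_le; apply: pl_edge.
rewrite /clamp; case: (lerP s 0) => s0; case: (lerP t 0) => t0.
- by rewrite subrr normr0.
- by rewrite min_r ?ler01//; case: (lerP 1 t) => t1; rewrite !ler0_norm; lra.
- by rewrite (@min_r _ _ 1 0) ?ler01//; case: (lerP 1 s) => s1; rewrite !ger0_norm; lra.
- case: (lerP 1 s) => s1; case: (lerP 1 t) => t1 //.
  + by rewrite subrr normr0.
  + by rewrite !ger0_norm; lra.
  + by rewrite !ler0_norm; lra.
Qed.

Lemma mdist_nearest p : mdist p (Vertex (nearest p)) <= 1.
Proof.
case: p => [v|e t] /=; first by rewrite mdistxx.
rewrite -edge_point_in -edge_point0; apply: (le_trans (mdist_edge_point _ _ _)).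
by have /andP[? ?] := valP t; rewrite subr0 ger0_norm ltW.
Qed.

Definition affine (h : vertex X -> R) p : R :=
  match p with
  | Vertex v => h v
  | Inner e t => (1 - val t) * h (source e) + val t * h (target e)
  end.

Lemma affine_edge_point h e (t : R) : 0 <= t <= 1 ->
  affine h (edge_point e t) = (1 - t) * h (source e) + t * h (target e).
Proof.
move=> /andP[t0 t1]; rewrite /edge_point; case: insubP => [u _ <-//|].
rewrite negb_and -!leNgt => /orP[t_le0|t_ge1].
- have -> : t = 0 by apply/eqP; rewrite eq_le t_le0.
  by rewrite lexx /= subr0 mul1r mul0r addr0.
- have -> : t = 1 by apply/eqP; rewrite eq_le t1.
  by rewrite ler10 /= subrr mul1r mul0r add0r.
Qed.

(** Combinatorial functions bound the path metric from below: this is how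
    distances in the realization are compared with other quantities. *)
Lemma affine_lipschitz (k : R) h p q : 0 < k ->
  (forall e, `|h (source e) - h (target e)| <= k) ->
  `|affine h p - affine h q| <= k * mdist p q.
Proof.
move=> k0 hk.
have half x y : affine h y / k <= affine h x / k + mdist x y.
  apply: (path_dist_lipschitz (h := fun x => affine h x / k)) => e s t s01 t01.
  rewrite !affine_edge_point// -lerBlDl -mulrBl ler_pdivrMr//.
  rewrite [X in X <= _](_ : _ = (t - s) * (h (target e) - h (source e))); last by ring.
  rewrite (le_trans (ler_norm _))// normrM distrC ler_wpM2l//.
  by rewrite distrC.
have {}half x y : affine h y <= affine h x + k * mdist x y.
  by rewrite -lerBlDl mulrC -ler_pdivrMr// mulrBl lerBlDl.
have := half p q; have := half q p; rewrite (metric_sym q) ler_norml => ? ?.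
by apply/andP; split; lra.
Qed.

Lemma edge_lipschitz_path (A : set Y) e (s t : R) :
  0 <= s <= 1 -> 0 <= t <= 1 -> (forall r, 0 <= r <= 1 -> A (edge_point e r)) ->
  lipschitz_path A (edge_point e s) (edge_point e t).
Proof.
move=> /andP[s0 s1] /andP[t0 t1] eA.
exists `|t - s|, (fun r => edge_point e (s + r * (t - s))); split=> //.
- move=> a b; apply: (le_trans (mdist_edge_point _ _ _)).
  by rewrite opprD addrACA subrr add0r -mulrBl normrM mulrC.
- by rewrite mul0r addr0.
- by rewrite mul1r addrC subrK.
- move=> r /andP[r0 r1]; apply: eA; apply/andP; split; nra.
Qed.

Lemma nearest_lipschitz_path (A : set Y) p :
  (forall q, mdist p q <= 1 -> A q) -> lipschitz_path A p (Vertex (nearest p)).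
Proof.
case: p => [v|e t] /= pA; first by apply/lipschitz_path_refl/pA; rewrite mdistxx.
rewrite -edge_point_in -edge_point0; have /andP[t0 t1] := valP t.
apply: edge_lipschitz_path; rewrite ?lexx ?ler01 ?ltW// => r /andP[r0 r1].
apply: pA; rewrite -edge_point_in; apply: (le_trans (mdist_edge_point _ _ _)).
by rewrite ler_norml; apply/andP; split; lra.
Qed.

Lemma oriented_edge_ends (x : edge X * bool) : exists s t : R,
  [/\ 0 <= s <= 1, 0 <= t <= 1, edge_point x.1 s = Vertex (origin x) :> Y &
      edge_point x.1 t = Vertex (terminus x) :> Y].
Proof.
case: x => e [] /=; [exists 1, 0|exists 0, 1];
  by rewrite edge_point0 edge_point1 !lexx ler01.
Qed.

Lemma walk_mdist u v w :
  walk u w v -> mdist (Vertex u : Y) (Vertex v) <= (size w)%:R.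
Proof.
elim: w u => [|x w IH] u /=; first by move=> ->; rewrite mdistxx.
move=> [<- /IH wv]; apply: (le_trans (metric_triangle _ (Vertex (terminus x)) _)).
rewrite -natr1 addrC lerD//; have [s [t [s01 t01 <- <-]]] := oriented_edge_ends x.
apply: (le_trans (mdist_edge_point _ _ _)); rewrite ler_norml.
by apply/andP; split; lra.
Qed.

Lemma walk_lipschitz_path (A : set Y) u v w : walk u w v ->
  (forall q, mdist (Vertex u) q <= (size w)%:R -> A q) ->
  lipschitz_path A (Vertex u) (Vertex v).
Proof.
elim: w u => [|x w IH] u /=.
  by move=> -> uA; apply/lipschitz_path_refl/uA; rewrite mdistxx.
move=> [<- wv] xA; have [s [t [s01 t01 sE tE]]] := oriented_edge_ends x.
have near_edge r : 0 <= r <= 1 -> mdist (Vertex (origin x)) (edge_point x.1 r : Y) <= 1.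
  move=> r01; rewrite -sE; apply: (le_trans (mdist_edge_point _ _ _)).
  by rewrite ler_norml; apply/andP; split; lra.
apply: (@lipschitz_path_trans _ _ _ (Vertex (terminus x))).
  rewrite -sE -tE; apply: edge_lipschitz_path => // r /near_edge r1.
  by apply: xA; rewrite (le_trans r1)// ler1n.
apply: IH wv _ => q wq; apply: xA.
apply: (le_trans (metric_triangle _ (Vertex (terminus x)) _)).
by rewrite -natr1 addrC lerD// -tE near_edge.
Qed.

End realization.

Section level_tree_metric.
Variables (R : realType) (V : choiceType) (E : V -> V -> Prop) (o : V).
Hypothesis E_sym : forall x y, E x y -> E y x.
Hypothesis E_conn : forall x y, joined E (fun=> True) x y.
Local Notation d := (gdist E_conn).
Local Notation len := (d o).
Local Notation T := (level_tree o E_conn).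
Local Notation pt x := (Vertex (x : vertex T) : realization R T).

Local Open Scope nat_scope.

Let up x (x0 : len x != 0) : @walk T x [:: (exist _ x x0, false)] (parent o E_conn x).
Proof. by []. Qed.

Let down x (x0 : len x != 0) : @walk T (parent o E_conn x) [:: (exist _ x x0, true)] x.
Proof. by []. Qed.

(** Both vertices hang from the same parent. *)
Lemma linked_walk x y : linked o E_conn x y -> exists2 w, @walk T x w y & size w <= 2.
Proof.
move=> xy; have [x0|x0] := eqVneq (len x) 0.
  exists [::] => //=; rewrite -(gdist_eq0 x0).
  by apply: (@gdist_eq0 _ _ E_conn); rewrite -xy.1.
have y0 : len y != 0 by rewrite -xy.1.
exists ([:: (exist _ x x0, false)] ++ [:: (exist _ y y0, true)]) => //.
apply/walk_cat; exists (parent o E_conn x) => //.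
by rewrite (linked_parent E_sym xy).
Qed.

(** If [y] is one step farther than [x] from the root, then [x] is linked to the
    parent of [y], which costs two edges, and one more edge leads to [y]. *)
Lemma level_tree_edge x y : E x y -> exists2 w, @walk T x w y & size w <= 3.
Proof.
move=> xy; have := gdist_triangle E_conn x o y; have := gdist_triangle E_conn y o x.
have := gdist_edge E_conn xy; rewrite (gdistC E_sym E_conn y x) => d1 lx ly.
have [lxy|lyx|lxy] := ltngtP (len x) (len y).
- have {}lxy : (len x).+1 = len y by lia.
  have y0 : len y != 0 by rewrite -lxy.
  have [w xw w2] := linked_walk (linked_predecessor E_sym xy lxy).
  exists (w ++ [:: (exist _ y y0, true)]); last by rewrite size_cat addn1.
  by apply/walk_cat; exists (parent o E_conn y).
- have {}lyx : (len y).+1 = len x by lia.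
  have x0 : len x != 0 by rewrite -lyx.
  have px_y := linked_sym E_sym (linked_predecessor E_sym (E_sym xy) lyx).
  have [w yw w2] := linked_walk px_y.
  by exists ((exist _ x x0, false) :: w).
- have [|w xw w2] := @linked_walk x y; last by exists w => //; apply: leqW.
  split=> //; apply: (joined_step (joined_refl _) xy) => //.
  by rewrite lxy.
Qed.

Lemma level_tree_steps x n y : steps E x n y ->
  exists2 w, @walk T x w y & size w <= 3 * n.
Proof.
elim=> [|{}n y' z _ [w xw wn] /level_tree_edge[w' yw w'3]]; first by exists [::].
exists (w ++ w'); last by rewrite size_cat mulnS addnC leq_add.
by apply/walk_cat; exists y'.
Qed.

Lemma level_tree_mdist_le x y :
  (mdist (pt x) (pt y) <= 3 * (d x y)%:R)%R.
Proof.
have [w xw wn] := level_tree_steps (gdist_steps E_conn x y).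
by rewrite (le_trans (walk_mdist R xw))// -natrM ler_nat.
Qed.

Variable Delta : nat.
Hypothesis thin : forall x y, linked o E_conn x y -> d x y <= Delta.

(** An edge of the tree joins [x] to a neighbour of a vertex linked to [x]. *)
Lemma level_tree_mdist_ge x y :
  ((d x y)%:R <= Delta.+1%:R * mdist (pt x) (pt y))%R.
Proof.
have near_parent (a : V) : len a != 0 -> d a (parent o E_conn a) <= Delta.+1.
  move=> a0; have [a' aa' [pa' _]] := parentP a0.
  rewrite -addn1 (leq_trans (gdist_triangle _ a' _ _))// leq_add ?thin//.
  exact/gdist_edge/E_sym.
have /= := @affine_lipschitz R T Delta.+1%:R (fun z => (d x z)%:R%R)
  (pt x) (pt y).
rewrite gdistxx sub0r normrN normr_nat; apply; first by rewrite ltr0Sn.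
move=> [a a0] /=.
rewrite ler_norml lerNl opprB !lerBlDr -!natrD !ler_nat.
have ap := near_parent a a0; apply/andP; split.
- apply: (leq_trans (gdist_triangle E_conn a x (parent o E_conn a))).
  by rewrite addnC leq_add2r.
- apply: (leq_trans (gdist_triangle E_conn (parent o E_conn a) x a)).
  by rewrite addnC leq_add2r gdistC.
Qed.

End level_tree_metric.

(** * The action on the tree of a group acting on a quasi-tree *)

Section group_on_tree.
Variables (R : realType) (G : groupType) (E : G -> G -> Prop).
Hypothesis E_sym : forall x y, E x y -> E y x.
Hypothesis E_conn : forall x y, joined E (fun=> True) x y.
Hypothesis E_mull : forall g x y, E x y -> E (g * x)%g (g * y)%g.
Local Notation d := (gdist E_conn).
Local Notation T := (level_tree 1%g E_conn).
Local Notation Y := (realization R T).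
Local Notation pt x := (Vertex (x : vertex T) : realization R T).

Lemma joined_mull (P : G -> Prop) g x y :
  joined E (fun z => P (g * z)%g) x y -> joined E P (g * x)%g (g * y)%g.
Proof.
elim=> [Px|y' z _ IH yz Pz]; first by left.
by apply: (joined_step IH) => //; apply: E_mull.
Qed.

Lemma steps_mull g x n y : steps E x n y -> steps E (g * x)%g n (g * y)%g.
Proof.
elim=> [|{}n y' z _ IH yz]; first exact: steps_refl.
by apply: (steps_step IH); apply: E_mull.
Qed.

Lemma gdist_mull g x y : d (g * x)%g (g * y)%g = d x y.
Proof.
apply/eqP; rewrite eqn_leq; apply/andP; split; apply: gdist_le.
  exact/steps_mull/gdist_steps.
rewrite -[x in steps _ x](mulKg g) -[y in steps _ _ _ y](mulKg g).
exact/steps_mull/gdist_steps.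
Qed.

Variable Delta : nat.
Hypothesis thin : forall x y : G, linked 1%g E_conn x y -> (d x y <= Delta)%N.
Local Notation k := (Delta.+1%:R : R).

Let dist_le (x y : G) : mdist (pt x) (pt y) <= 3 * (d x y)%:R.
Proof. exact: level_tree_mdist_le. Qed.

Let dist_ge (x y : G) : (d x y)%:R <= k * mdist (pt x) (pt y).
Proof. exact: level_tree_mdist_ge. Qed.

(** The inclusion of [G] as the vertex set of the tree is a quasi-isometry for
    the graph distance, which is invariant; the left multiplications of [G] are
    transported along it. *)
Definition tree_action (g : G) (p : Y) : Y := pt (g * nearest p)%g.

Let mdist_nearest_le (p q : Y) :
  mdist (pt (nearest p)) (pt (nearest q)) <= mdist p q + 2.
Proof.
have := metric_triangle (pt (nearest p)) p (pt (nearest q)).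
have := metric_triangle p q (pt (nearest q)).
have := mdist_nearest p; have := mdist_nearest q.
by rewrite (metric_sym (pt (nearest p)) p); lra.
Qed.

Let mdist_nearest_ge (p q : Y) :
  mdist p q <= mdist (pt (nearest p)) (pt (nearest q)) + 2.
Proof.
have := metric_triangle p (pt (nearest p)) q.
have := metric_triangle (pt (nearest p)) (pt (nearest q)) q.
have := mdist_nearest p; have := mdist_nearest q.
by rewrite (metric_sym (pt (nearest q)) q); lra.
Qed.

Lemma tree_quasi_action : quasi_action tree_action.
Proof.
have k1 : 1 <= k by rewrite ler1n.
exists (3 * k), (6 * k); split; [lra|lra|split].
- move=> g; split=> [x1 x2|y].
  + have up := mdist_nearest_le x1 x2; have low := mdist_nearest_ge x1 x2.
    have d_le := dist_ge (nearest x1) (nearest x2).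
    have d_ge := dist_le (nearest x1) (nearest x2).
    have gd_le := dist_ge (g * nearest x1)%g (g * nearest x2)%g.
    have gd_ge := dist_le (g * nearest x1)%g (g * nearest x2)%g.
    rewrite gdist_mull in gd_le; rewrite gdist_mull in gd_ge.
    rewrite /tree_action; move: (mdist (pt (nearest x1)) _) (mdist x1 x2)
      (mdist (pt (g * nearest x1)%g) _) up low d_le d_ge gd_le gd_ge => a b c *.
    apply/andP; split; last by nra.
    rewrite lerBlDr ler_pdivrMr; last by lra.
    by nra.
  + exists (pt (g^-1 * nearest y)%g); rewrite /tree_action /= mulVKg.
    by rewrite (le_trans (mdist_nearest _))//; lra.
- by move=> g h x; rewrite /tree_action /= mulgA mdistxx; lra.
Qed.

Lemma tree_cobounded : cobounded tree_action.
Proof.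
move=> x; exists 1 => y; exists (nearest y * (nearest x)^-1)%g.
by rewrite /tree_action mulgVK mdist_nearest.
Qed.

(** For every [M] there are three rays outside the ball of radius [M] about
    the identity that go to infinity and that the ball of the fixed radius [r]
    separates.  The radius must not grow with [M]: this leaves room for the
    constants of a quasi-isometry. *)
Definition three_ended : Prop :=
  exists r : nat, forall M : nat, exists rho : nat -> nat -> G,
    [/\ forall i n, rho i n = rho i n.+1 \/ E (rho i n) (rho i n.+1),
        forall i n, (M <= d 1%g (rho i n))%N,
        forall i N, exists n, (N <= d 1%g (rho i n))%N &
        forall i j, (i < 3)%N -> (j < 3)%N -> i <> j ->
          ~ joined E (fun z => r <= d 1%g z)%N (rho i 0%N) (rho j 0%N)].

(** A path in the tree outside a large ball, read off at the nearest vertices,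
    moves by bounded jumps in the graph; filling the jumps by geodesics gives a
    path outside a slightly smaller ball.  So translates of the three separated
    rays land in three different components. *)
Lemma tree_bushy : three_ended -> bushy Y.
Proof.
move=> [r ends]; have k1 : 1 <= k by rewrite ler1n.
(* A jump has length at most 3 * Delta.+1 in the graph, so paths through
   vertices at distance m from the centre avoid the ball of radius r; outside
   the ball of radius B of the tree the nearest vertex has distance at least
   m. *)
pose m := (r + 3 * Delta.+1)%N; pose B := (3 * m + 2)%N.
exists B%:R => x; set A := ~` ball x B%:R.
have AE q : A q <-> B%:R <= mdist x q.
  by rewrite /A /setC /= ballEmdist /= leNgt; split=> [/negP|/negP].
have [rho [rho_step rho_far rho_unbd rho_sep]] := ends (Delta.+1 * (B + 4))%N.
pose v := nearest x; pose pnt i n := pt (v * rho i n)%g.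
(* The margin 3 covers the walk in the tree along one step of a ray. *)
have far i n : (B + 3)%:R <= mdist x (pnt i n).
  have tri := metric_triangle (pt v) x (pnt i n).
  have vx : mdist (pt v) x <= 1 by rewrite metric_sym mdist_nearest.
  have := dist_ge v (v * rho i n)%g.
  have -> : d v (v * rho i n)%g = d 1%g (rho i n).
    by have := gdist_mull v 1%g (rho i n); rewrite mulg1.
  move=> dk; have : k * (B + 4)%:R <= k * mdist (pt v) (pnt i n).
    by apply: le_trans dk; rewrite -natrM ler_nat.
  rewrite ler_pM2l; last by lra.
  by rewrite !natrD; lra.
have path_rho i n : lipschitz_path A (pnt i 0%N) (pnt i n).
  elim: n => [|n IH].
    by apply/lipschitz_path_refl/AE/(le_trans _ (far i 0%N)); rewrite ler_nat leq_addr.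
  case: (rho_step i n) => [nE|nE]; first by rewrite /pnt -nE.
  apply: lipschitz_path_trans IH _.
  have [w nw w3] := @level_tree_edge _ _ 1%g E_sym E_conn _ _ (E_mull v nE).
  apply: walk_lipschitz_path nw _ => q nq; apply/AE.
  have := metric_triangle x q (pnt i n); have := far i n.
  have : (size w)%:R <= 3%:R :> R by rewrite ler_nat.
  by move: nq; rewrite natrD (metric_sym q) /pnt; lra.
have comp_rho i n : path_component A (pnt i 0%N) (pnt i n).
  exact/lipschitz_pathP/path_rho.
have Arho i n : A (pnt i n).
  have [g [_ _ <- gA]] := comp_rho i n; apply: gA; exists 1 => //.
  by rewrite /= in_itv /= ler01 lexx.
have coarse u : B%:R <= mdist x u -> (m <= d v (nearest u))%N.
  move=> xu; have := mdist_nearest_ge x u; have := dist_le v (nearest u).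
  rewrite -/v => le1 le2; rewrite -(ler_nat R).
  have : B%:R <= 3 * (d v (nearest u))%:R + 2 :> R by lra.
  by rewrite /B natrD natrM; lra.
suff /injfunPex : exists2 f : nat -> set Y,
    set_fun `I_3 [set C | [set path_component A p | p in A] C /\ unbounded C] f &
    set_inj `I_3 f by move=> [F]; exact: inj_card_le F.
exists (fun i => path_component A (pnt i 0%N)) => [i _|i j].
  split; first by exists (pnt i 0%N).
  move=> M; have [n nE] :=
    rho_unbd i (d 1%g (rho i 0%N) + (Delta.+1 * (Num.trunc M).+1))%N.
  exists (pnt i 0%N), (pnt i n); split; [exact: comp_rho|exact: comp_rho|].
  have := dist_ge (v * rho i 0%N)%g (v * rho i n)%g; rewrite gdist_mull => dk.
  have := gdist_triangle E_conn (rho i 0%N) 1%g (rho i n) => tri.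
  have {}nE : (Delta.+1 * (Num.trunc M).+1 <= d (rho i 0%N) (rho i n))%N.
    by rewrite -(leq_add2l (d 1%g (rho i 0%N))) (leq_trans nE).
  move: nE; rewrite -(ler_nat R) natrM => nE; have := le_trans nE dk.
  rewrite ler_pM2l; last by lra.
  exact: lt_le_trans (truncnS_gt _).
rewrite !inE => i3 j3 /= eq_comp; apply: contrapT => /rho_sep.
have [g [gc g0 g1 gA]] : path_component A (pnt i 0%N) (pnt j 0%N).
  by rewrite eq_comp; apply: (comp_rho j 0%N).
case=> //; have {}gA t : 0 <= t <= 1 -> B%:R <= mdist x (g t).
  by move=> t01; apply/AE/gA; exists t => //=; rewrite in_itv.
pose far_from_v z := (r <= d v z)%N.
have : joined E far_from_v (v * rho i 0%N)%g (nearest (g 1)).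
  pose reached t := joined E far_from_v (v * rho i 0%N)%g (nearest (g t)).
  apply: (@clopen_induction _ reached 1) => //.
    rewrite /reached g0 /=; left; rewrite /far_from_v.
    apply: leq_trans (coarse (pnt i 0%N) _); first exact: leq_addr.
    exact/AE.
  move=> t t01; have tI : `[0, 1]%classic t by rewrite /= in_itv.
  have [eps eps0 near_t] := within_continuous_mdist gc tI ltr01.
  exists eps => // s s01 st.
  suff ts : joined E far_from_v (nearest (g t)) (nearest (g s)).
    split=> H; last exact: joined_trans H ts.
    exact: joined_trans H (joined_sym E_sym ts).
  have d3 : (d (nearest (g t)) (nearest (g s)) <= 3 * Delta.+1)%N.
    rewrite -(ler_nat R) natrM; apply: (le_trans (dist_ge _ _)).
    have := mdist_nearest_le (g t) (g s).
    have := near_t s; rewrite /= in_itv => /(_ s01 st).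
    by nra.
  have mt := coarse _ (gA t t01).
  apply: joined_sub (joined_near E_conn (nearest (g t)) (nearest (g s))) => z tz.
  rewrite /far_from_v; have := gdist_triangle E_conn z v (nearest (g t)).
  rewrite (gdistC E_sym E_conn z); move: tz d3 mt; rewrite /m; lia.
rewrite g1 /= => vij.
rewrite -[rho i 0%N](mulKg v) -[rho j 0%N](mulKg v).
apply: joined_mull; apply: joined_sub vij => z.
by rewrite /far_from_v -(gdist_mull v^-1%g v) mulVg.
Qed.

End group_on_tree.

(** * The graph of flat paths *)

Section pseudocharacter_graph.
Variables (R : realType) (G : groupType) (S : triangular_generating_set G).
Variables (f : G -> R) (D lam K : R).
Hypothesis f_quasi : forall a b : G, `|f a + f b - f (a * b)%g| <= D.
Hypothesis f1 : f 1%g = 0.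
Hypothesis lam0 : 0 < lam.
Hypothesis f_adj : forall x y, adj S x y -> `|f x - f y| <= lam.
Hypothesis K_ge : 4 * lam + 2 * D <= K.
Local Notation Adj := (adj S).

Let D0 : 0 <= D. Proof. exact: le_trans (normr_ge0 _) (f_quasi 1%g 1%g). Qed.

Let f_translate x y : `|f (x^-1 * y)%g - (f y - f x)| <= D.
Proof. by have := f_quasi x (x^-1 * y)%g; rewrite mulVKg opprB addrCA addrA. Qed.

(** The unit [lam] bounds the variation of [f] along an edge, so that neighbours
    are on equal or consecutive levels. *)
Definition height (x : G) : int := Num.floor (f x / lam).
Local Notation same_comp := (same_comp Adj height).

Lemma height_adj x y : Adj x y -> `|height x - height y| <= 1.
Proof.
move=> xy; have := f_adj xy; rewrite /height.
have := floor_itv (f x / lam); have := floor_itv (f y / lam).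
move: (Num.floor _) (Num.floor _) => m n /andP[ym my] /andP[xn nx] /ler_normlP[xy1 xy2].
rewrite ler_pdivlMr// in ym; rewrite ler_pdivlMr// in xn.
rewrite ltr_pdivrMr// in my; rewrite ltr_pdivrMr// in nx.
have lt_nm : n%:~R < (m + 2)%:~R :> R.
  by rewrite -(ltr_pM2r lam0); rewrite !rmorphD /= in my nx *; nra.
have lt_mn : m%:~R < (n + 2)%:~R :> R.
  by rewrite -(ltr_pM2r lam0); rewrite !rmorphD /= in my nx *; nra.
by rewrite !ltr_int in lt_nm lt_mn; lia.
Qed.

Lemma same_comp_f x y : same_comp x y -> `|f x - f y| <= lam.
Proof.
move=> xy; have := same_comp_h xy; rewrite /height => hxy.
have := floor_itv (f x / lam); have := floor_itv (f y / lam); rewrite hxy.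
move: (Num.floor _) => m /andP[ym my] /andP[xm mx].
rewrite ler_pdivlMr// in ym; rewrite ler_pdivlMr// in xm.
rewrite ltr_pdivrMr// rmorphD /= in my; rewrite ltr_pdivrMr// rmorphD /= in mx.
by rewrite ler_norml; apply/andP; split; lra.
Qed.

(** Up to the defect [D] the condition says that [f] varies by at most [K] along
    the path.  It is stated through [z^-1 * w], rather than through
    [f w - f z], to be left-invariant. *)
Definition flat (x y : G) : Prop :=
  exists2 P : G -> Prop, (forall z w, P z -> P w -> `|f (z^-1 * w)%g| <= K) &
    joined Adj P x y.

Lemma flat_sym x y : flat x y -> flat y x.
Proof. by move=> [P PK xy]; exists P => //; apply: joined_sym xy; apply: adj_sym. Qed.

Lemma flat_mull g x y : flat x y -> flat (g * x)%g (g * y)%g.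
Proof.
move=> [P PK xy]; exists (fun z => P (g^-1 * z)%g).
  by move=> z w Pz /(PK _ _ Pz); rewrite invgM invgK -mulgA mulVKg.
elim: xy => [Px|y' z _ IH yz Pz]; first by left; rewrite mulKg.
by apply: (joined_step IH); [exact: adj_mull|rewrite mulKg].
Qed.

Lemma flat_band (m M : R) x y : M - m <= K - D ->
  joined Adj (fun z => m <= f z <= M) x y -> flat x y.
Proof.
move=> mM xy; exists (fun z => m <= f z <= M) => // z w /andP[? ?] /andP[? ?].
have /ler_normlP[? ?] := f_translate z w.
by rewrite ler_norml; apply/andP; split; lra.
Qed.

Lemma flat_refl x : flat x x.
Proof.
have l0 := lam0; have Kl := K_ge; have D_ge0 := D0.
by apply: (@flat_band (f x) (f x)); [lra|left; rewrite lexx].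
Qed.

Lemma flat_adj x y : Adj x y -> flat x y.
Proof.
move=> xy; have /ler_normlP[? ?] := f_adj xy.
have l0 := lam0; have Kl := K_ge; have D_ge0 := D0.
apply: (@flat_band (f x - lam) (f x + lam)); first lra.
apply: (joined_step (joined_refl _) xy); apply/andP; split; lra.
Qed.

Lemma flat_same x y : same_comp x y -> flat x y.
Proof.
move=> xy; have l0 := lam0; have Kl := K_ge; have D_ge0 := D0.
apply: (@flat_band (f x - lam) (f x + lam)); first lra.
apply: joined_sub (joined_prefix xy) => z /same_comp_f/ler_normlP[? ?].
by apply/andP; split; lra.
Qed.

Lemma flat_conn x y : joined flat (fun=> True) x y.
Proof.
elim: (adj_connected S x y) => [_|y' z _ IH yz _]; first by left.
by apply: (joined_step IH) => //; apply: flat_adj.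
Qed.

Lemma flat_f x y : flat x y -> `|f x - f y| <= K + D.
Proof.
move=> [P PK xy]; have := PK _ _ (joined_l xy) (joined_r xy).
have := f_translate x y; rewrite !ler_norml => /andP[? ?] /andP[? ?].
by apply/andP; split; lra.
Qed.

(** A flat edge is realized by a path in the Cayley graph, all of whose points are
    again flat neighbours of its origin. *)
Lemma joined_flat P x y : joined flat P x y ->
  joined Adj (fun z => exists2 z', P z' & flat z' z) x y.
Proof.
elim=> [Px|y' z xy IH [Q QK yz] Pz].
  by left; exists x => //; exact: flat_refl.
apply: (joined_trans IH); apply: joined_sub (joined_prefix yz) => w yw.
by exists y'; [exact: joined_r xy|exists Q].
Qed.

Local Notation d := (gdist flat_conn).

Lemma gdist_f x y : `|f x - f y| <= (K + D) * (d x y)%:R.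
Proof. by apply: gdist_lipschitz => u v; apply: flat_f. Qed.

Local Notation bott := (bottleneck Adj height).

Let bott_joined x y : joined Adj (bott x y) x y.
Proof. exact/cayley_bottleneck/height_adj. Qed.

Let d_sym x y : d x y = d y x. Proof. exact: gdistC flat_sym _ _ _. Qed.

(** Let [u] be on the bottleneck path from [x] to [y].  The path outside the ball
    passes near [u], so [u] is nearly as far from the identity as [x] and [y].
    The path through the identity made of two geodesics passes near [u] too, and
    at such a point of a geodesic one is close to its end [x] or [y].  The
    bottleneck path moves by unit steps from [x] to [y], so somewhere it is close
    to both. *)
Lemma flat_thin x y : linked 1%g flat_conn x y -> (d x y <= 13)%N.
Proof.
move=> [lxy0 xy0]; pose n := d 1%g x; have lxy : n = d 1%g y := lxy0.
have {lxy0 xy0} xy : joined flat (fun z => n <= d 1%g z)%N x y := xy0.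
have nE : n = d 1%g x by []; clearbody n.
(* The point of a geodesic near u is at distance at most 2 from u; as u is at
   level at least n - 2, that point is at distance at most 4 from the end. *)
have near u : bott x y u -> (d x u <= 6)%N \/ (d y u <= 6)%N.
  move=> bu.
  have len_u : (n <= d 1%g u + 2)%N.
    have [u' [z' nz' z'u'] uu'] := bu _ (joined_flat xy).
    have := gdist_edge flat_conn z'u'; have := gdist_edge flat_conn (flat_same uu').
    have := gdist_triangle flat_conn u' 1%g z'; have := gdist_triangle flat_conn u 1%g u'.
    move: nz'; rewrite (d_sym z' u') /=; lia.
  have x1y : joined flat (fun z => d x z + d z 1%g = n \/ d 1%g z + d z y = n)%N x y.
    apply: (@joined_trans _ _ _ 1%g).
      apply: joined_sub (gdist_geodesic flat_conn x 1%g) => z ->.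
      by left; rewrite d_sym nE.
    apply: joined_sub (gdist_geodesic flat_conn 1%g y) => z ->.
    by right; rewrite lxy.
  have [u' [z' nz' z'u'] uu'] := bu _ (joined_flat x1y).
  have := gdist_edge flat_conn z'u'; have := gdist_edge flat_conn (flat_same uu').
  have := gdist_triangle flat_conn u' z' u; have := gdist_triangle flat_conn z' 1%g u.
  have := gdist_triangle flat_conn z' x u; have := gdist_triangle flat_conn z' y u.
  rewrite (d_sym u' u); move: nz'; rewrite (d_sym z' 1%g) (d_sym z' y).
  by case=> [xz|zy]; [left|right]; lia.
(* The walk from x along bottlenecks stays close to x until it meets a point
   close to y. *)
have walk v : joined Adj (bott x y) x v -> (d x v <= 6)%N \/ (d x y <= 13)%N.
  elim=> {v} [_|u u' _ [IH|IH] uu' /near[xu'|yu']].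
  - by left; rewrite gdistxx.
  - by left.
  - right; have := gdist_edge flat_conn (flat_adj uu').
    have := gdist_triangle flat_conn u x y; have := gdist_triangle flat_conn u' u y.
    by rewrite (d_sym u' y); lia.
  - by right.
  - by right.
by have [/leq_trans->|] := walk _ (bott_joined x y).
Qed.

Variables (C : R) (up down : nat -> G).
Hypothesis K_ge' : C + 2 * D + 4 * lam <= K.
Hypothesis up0 : up 0%N = 1%g.
Hypothesis down0 : down 0%N = 1%g.
Hypothesis up_step : forall n, up n = up n.+1 \/ Adj (up n) (up n.+1).
Hypothesis down_step : forall n, down n = down n.+1 \/ Adj (down n) (down n.+1).
Hypothesis up_ge : forall n, - C <= f (up n).
Hypothesis down_le : forall n, f (down n) <= C.
Hypothesis up_unbd : forall M, exists n, M <= f (up n).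
Hypothesis down_unbd : forall M, exists n, f (down n) <= M.
(** The peaks [a] and [b] will be points high up on two inequivalent rays. *)
Hypothesis split_peaks : forall M, exists (c : R) a b,
  [/\ c - 3 * lam <= f a, c - 3 * lam <= f b,
      joined Adj (fun z => f z <= c) a b &
      ~ joined Adj (fun z => c - M <= f z <= c + lam) a b].

Let ray_joined (r : nat -> G) x m (M : R) :
  r 0%N = 1%g -> (forall n, r n = r n.+1 \/ Adj (r n) (r n.+1)) ->
  (forall n, f (x * r n)%g <= M) ->
  joined Adj (fun z => f z <= M) x (x * r m)%g.
Proof.
move=> r0 r_step rM; elim: m => [|m IH].
  by rewrite r0 mulg1; left; rewrite -[x]mulg1 -r0.
case: (r_step m) => [<-//|mE]; apply: (joined_step IH) => //; exact: adj_mull.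
Qed.

(** Since [z] is a bottleneck, a path from [x] to [y] visits its piece, and can be
    stopped there. *)
Let descend x y z (m : R) P :
  joined Adj P x y -> bott x y z -> (forall u, P u -> m <= f u) ->
  m <= f z - lam -> joined Adj (fun u => m <= f u) z x.
Proof.
move=> xy bz Pm mz; have [z' xz' zz'] := bz _ (joined_prefix xy).
apply: (joined_trans (y := z')).
  apply: joined_sub (joined_prefix zz') => w /same_comp_f/ler_normlP[? ?]; lra.
by apply: joined_sub (joined_sym _ xz'); [exact: Pm|exact: adj_sym].
Qed.

(** Let [z] be the lowest bottleneck between the two peaks [a] and [b], up to the
    height of a piece.  Paths from [a] to [b] visit the piece of [z].  Let [e] be
    far below [z].  A bottleneck path from [z] to a peak never goes much below
    [z], because [z] is lowest.  As long as it does not go much above [z]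
    either, its points are flat neighbours of [z]; the first time that it does,
    it leaves the pieces met by the descent from [z] to [e], and then any path
    from [e] to the peak has to visit its piece.  So all paths between two of
    the points [a], [b], [e] pass close to [z]. *)
Lemma flat_three_ended : three_ended flat_conn.
Proof.
have l0 := lam0; have Kl := K_ge; have D_ge0 := D0; have Kl' := K_ge'.
have K0 : 0 < K + D by lra.
(* Paths of the Cayley graph come within distance 3 of z; a flat edge may jump
   over such a point by 1 more. *)
exists 5%N => M.
(* Points whose heights differ by M * (K + D) are at distance at least M; the
   other terms absorb the defect, the deviation of the rays and the height of
   the pieces. *)
have [c [a [b [ca cb ab low]]]] := split_peaks (M%:R * (K + D) + 7 * lam + C + D).
have C0 : 0 <= C by have := up_ge 0%N; rewrite up0 f1 oppr_le0.
have MK : 0 <= M%:R * (K + D) by rewrite mulr_ge0// ltW.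
have bott_le u : bott a b u -> f u <= c + lam.
  by move=> bu; have [u' u'c /same_comp_f/ler_normlP[? ?]] := bu _ ab; lra.
have [u0 bu0 fu0] : exists2 u,
    bott a b u & f u < c - (M%:R * (K + D) + 7 * lam + C + D).
  apply: contrapT => H; apply: low; apply: joined_sub (bott_joined a b) => u bu.
  rewrite bott_le// andbT leNgt; apply/negP => fu; apply: H; by exists u.
have [m abm] := joined_bounded (fun u => - f u) (adj_connected S a b).
pose H := [set f u | u in bott a b].
have hH : has_inf H.
  split; first by exists (f u0), u0.
  exists (- m - lam) => _ [u bu <-].
  have [u' u'm /same_comp_f/ler_normlP[? ?]] := bu _ abm; lra.
have [_ [z bz <-] fz] := inf_adherent lam0 hH.
have inf_le u : bott a b u -> inf H <= f u.
  by move=> bu; apply: ge_inf; [exact: hH.2|exists u].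
have z_min u : bott a b u -> f z - lam <= f u by move=> /inf_le; lra.
have fz_low : f z < c - (M%:R * (K + D) + 6 * lam + C + D).
  by have := inf_le _ bu0; lra.
have za : joined Adj (fun u => f z - lam <= f u) z a.
  exact: (descend (bott_joined a b)).
have zb : joined Adj (fun u => f z - lam <= f u) z b.
  apply: (descend (joined_sym (@adj_sym _ S) (bott_joined a b))) => //.
  by apply: (bottleneck_sym (@adj_sym _ S)).
pose meet x y := forall P, joined Adj P x y -> exists2 w, P w & (d z w <= 3)%N.
have meet_sym x y : meet x y -> meet y x.
  by move=> xy P /(joined_sym (@adj_sym _ S)); apply: xy.
have meet_ab : meet a b.
  move=> P /bz[w Pw zw]; exists w => //.
  by apply: leq_trans (gdist_edge flat_conn (flat_same zw)) _.
have [n0 fn0] := down_unbd (- (M%:R * (K + D) + C + 2 * D)).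
pose e := (z * down n0)%g.
have fe : f e <= f z - (M%:R * (K + D) + C + D).
  by have /ler_normlP[? ?] := f_quasi z (down n0); rewrite /e; lra.
have ze : joined Adj (fun u => f u <= f z + C + D) z e.
  apply: ray_joined => // n; have /ler_normlP[? ?] := f_quasi z (down n).
  by have := down_le n; lra.
have meet_e x : c - 3 * lam <= f x ->
    joined Adj (fun u => f z - lam <= f u) z x -> meet e x.
  move=> cx zx P ex.
  pose band u := f z - 2 * lam <= f u <= f z + C + D + lam.
  have zband : band z by apply/andP; split; lra.
  have band_flat u : joined Adj band z u -> flat z u by apply: flat_band; lra.
  (* As long as the walk stays in the band it remains a flat neighbour of z. *)
  have walk v : joined Adj (bott z x) z v ->
      (exists2 w, P w & (d z w <= 3)%N) \/ joined Adj band z v.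
    elim=> {v} [_|u u' _ [zP|zu] uu' bu']; [by right; left|by left|].
    have [|w [fw|Pw] u'w] := bu' (fun u => f u <= f z + C + D \/ P u).
    - apply: (joined_trans (y := e)); first by apply: joined_sub ze; left.
      by apply: joined_sub ex; right.
    - right; apply: (joined_step zu uu').
      have [w' zw' /same_comp_f/ler_normlP[? ?]] := bu' _ zx.
      have /ler_normlP[? ?] := same_comp_f u'w.
      by apply/andP; split; lra.
    - left; exists w => //.
      have zu1 := gdist_edge flat_conn (band_flat _ zu).
      have uu1 := gdist_edge flat_conn (flat_adj uu').
      have uw1 := gdist_edge flat_conn (flat_same u'w).
      apply: leq_trans (gdist_triangle flat_conn u z w) (leq_add zu1 _).
      exact: leq_trans (gdist_triangle flat_conn u' u w) (leq_add uu1 uw1).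
  have [//|zx'] := walk _ (bott_joined z x).
  by have /andP[_ fx] : band x := joined_r zx'; exfalso; lra.
have meet_ea := meet_e a ca za; have meet_eb := meet_e b cb zb.
pose base (i : nat) := match i with 0%N => a | 1%N => b | _ => e end.
pose ray (i : nat) := match i with 0%N | 1%N => up | _ => down end.
have ray0 i : ray i 0%N = 1%g by case: i => [|[|i]].
have ray_step i n : ray i n = ray i n.+1 \/ Adj (ray i n) (ray i n.+1).
  by case: i => [|[|i]].
pose rho i n := (z^-1 * (base i * ray i n))%g.
have drho i n : d 1%g (rho i n) = d z (base i * ray i n)%g.
  by rewrite -(gdist_mull flat_conn flat_mull z^-1%g z) mulVg.
exists rho; split.
- move=> i n; case: (ray_step i n) => [nE|nE]; first by left; rewrite /rho nE.
  by right; apply/flat_adj/adj_mull/adj_mull.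
- move=> i n; rewrite drho.
  suff far : M%:R * (K + D) <= `|f z - f (base i * ray i n)%g|.
    rewrite -(ler_nat R) -(ler_pM2r K0) (le_trans far)// [leRHS]mulrC.
    exact: gdist_f.
  have : f z - f (base i * ray i n)%g <= - (M%:R * (K + D)) \/
         M%:R * (K + D) <= f z - f (base i * ray i n)%g.
    case: i => [|[|i]] /=; [left|left|right].
    + by have /ler_normlP[? ?] := f_quasi a (up n); have := up_ge n; lra.
    + by have /ler_normlP[? ?] := f_quasi b (up n); have := up_ge n; lra.
    + by have /ler_normlP[? ?] := f_quasi e (down n); have := down_le n; lra.
  by case=> ?; [rewrite ler0_norm|rewrite ger0_norm]; lra.
- move=> i N.
  have [n far] : exists n, (K + D) * N%:R <= `|f z - f (base i * ray i n)%g|.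
    case: i => [|[|i]] /=.
    + have [n fn] := up_unbd (`|f z| + `|f a| + D + (K + D) * N%:R); exists n.
      have /ler_normlP[? ?] := f_quasi a (up n).
      have := ler_norm (f z); have := ler_norm (- f a); rewrite normrN => ? ?.
      by rewrite distrC; apply: le_trans (ler_norm _); lra.
    + have [n fn] := up_unbd (`|f z| + `|f b| + D + (K + D) * N%:R); exists n.
      have /ler_normlP[? ?] := f_quasi b (up n).
      have := ler_norm (f z); have := ler_norm (- f b); rewrite normrN => ? ?.
      by rewrite distrC; apply: le_trans (ler_norm _); lra.
    + have [n fn] := down_unbd (- (`|f z| + `|f e| + D + (K + D) * N%:R)); exists n.
      have /ler_normlP[? ?] := f_quasi e (down n).
      have := ler_norm (- f z); have := ler_norm (f e); rewrite normrN => ? ?.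
      by apply: le_trans (ler_norm _); lra.
  exists n; rewrite drho -(ler_nat R) -(ler_pM2l K0); exact: le_trans far (gdist_f _ _).
- move=> i j i3 j3 ij path_ij.
  have path' : joined flat (fun w => 5 <= d z w)%N (base i) (base j).
    rewrite -[base i](mulVKg z) -[base j](mulVKg z).
    apply: (joined_mull flat_mull); move: path_ij; rewrite /rho !ray0 !mulg1.
    apply: joined_sub => w; rewrite -(gdist_mull flat_conn flat_mull z 1%g) mulg1.
    by [].
  have : meet (base i) (base j).
    case: i j i3 j3 ij {path_ij path'} => [|[|[|i]]] [|[|[|j]]] //= _ _ _;
      exact/meet_sym.
  move=> /(_ _ (joined_flat path'))[w [w' zw' w'w] zw].
  have w1 := gdist_edge flat_conn w'w; rewrite d_sym in w1.
  by have := leq_trans zw' (leq_trans (gdist_triangle flat_conn w z w') (leq_add zw w1)).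
Qed.

End pseudocharacter_graph.

(** * Pseudocharacters along rays *)

Section pseudocharacter_facts.
Variables (R : realType) (G : groupType) (f : G -> R).
Hypothesis f_pc : pseudocharacter f.

Lemma pseudocharacterN : pseudocharacter (fun g => - f g).
Proof.
have [fX [C fC]] := f_pc; split=> [a n|]; first by rewrite fX mulrN.
by exists C => a b; rewrite -!opprD normrN.
Qed.

Lemma pseudocharacter1 : f 1%g = 0.
Proof. by have := f_pc.1 1%g 0; rewrite /= expg0 mul0r. Qed.

Lemma pseudocharacterX a n : f (a ^+ n)%g = n%:R * f a.
Proof. exact: (f_pc.1 a n). Qed.

Lemma pseudocharacterV a : f a^-1%g = - f a.
Proof. by have := f_pc.1 a (-1); rewrite /= expg1 mulN1r. Qed.

Variable S : triangular_generating_set G.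

Lemma pseudocharacter_adj : exists2 lam, 0 < lam &
  forall x y, adj S x y -> `|f x - f y| <= lam.
Proof.
have [_ [D fD]] := f_pc; have D0 : 0 <= D := le_trans (normr_ge0 _) (fD 1%g 1%g).
pose B := \sum_(s : seq_sub S) `|f (val s)|.
have B_ge (s : seq_sub S) : `|f (val s)| <= B.
  by rewrite /B (bigD1 s)//= lerDl sumr_ge0.
have B0 : 0 <= B by rewrite sumr_ge0.
have step x (s : seq_sub S) : `|f x - f (x * val s)%g| <= D + B + 1.
  have /ler_normlP[? ?] := fD x (val s); have /ler_normlP[? ?] := B_ge s.
  by rewrite ler_norml; apply/andP; split; lra.
exists (D + B + 1); first by lra.
by move=> x y [s [->|->]]; rewrite ?step// distrC step.
Qed.

(** Run through the powers of an element [a] with [0 < f a], following a fixed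
    word for [a] between consecutive powers: at time [n = q * k + r] the height is
    [q * f a] up to a bounded error. *)
Lemma ascending_ray : (exists g, f g != 0) -> exists (C : R) (v : nat -> G),
  [/\ v 0%N = 1%g, forall n, v n = v n.+1 \/ adj S (v n) (v n.+1),
      forall n, - C <= f (v n) &
      forall M, exists N, forall n, (N <= n)%N -> M <= f (v n)].
Proof.
move=> [g g0]; have [a a0] : exists a, 0 < f a.
  have [g_gt|g_lt|g_eq] := ltrgtP 0 (f g); first by exists g.
    by exists g^-1%g; rewrite pseudocharacterV oppr_gt0.
  by rewrite -g_eq eqxx in g0.
have [_ [D fD]] := f_pc; have D0 : 0 <= D := le_trans (normr_ge0 _) (fD 1%g 1%g).
have [k ak] := joined_steps (adj_connected S 1%g a).
have k0 : (0 < k)%N.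
  by case: k ak => // a1; inversion a1; subst a; rewrite pseudocharacter1 ltxx in a0.
have [u [u0 uk u_adj]] := steps_fun ak.
pose C := \sum_(i < k) `|f (u i)| + D.
pose v n := (a ^+ (n %/ k)%N * u (n %% k)%N)%g.
have v_ge n : (n %/ k)%N%:R * f a - C <= f (v n).
  have /ler_normlP[? ?] := fD (a ^+ (n %/ k)%N)%g (u (n %% k)%N).
  have : `|f (u (n %% k)%N)| <= \sum_(i < k) `|f (u i)|.
    by rewrite (bigD1 (Ordinal (ltn_pmod n k0)))//= lerDl sumr_ge0.
  by rewrite -pseudocharacterX /C => /ler_normlP[? ?]; rewrite /v; lra.
exists C, v; split.
- by rewrite /v div0n mod0n u0 expg0 mulg1.
- move=> n; right; rewrite /v.
  have step := u_adj _ (ltn_pmod n k0).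
  have [lt_k|ge_k] := ltnP (n %% k)%N.+1 k.
    have -> : (n.+1 %/ k = n %/ k)%N.
      by rewrite {1}(divn_eq n k) -addnS divnMDl// (divn_small lt_k) addn0.
    have -> : (n.+1 %% k = (n %% k)%N.+1)%N.
      by rewrite {1}(divn_eq n k) -addnS modnMDl (modn_small lt_k).
    exact: adj_mull.
  have nk : (n %% k)%N.+1 = k by apply/eqP; rewrite eqn_leq ge_k ltn_pmod.
  have nE : n.+1 = ((n %/ k).+1 * k)%N by rewrite {1}(divn_eq n k) -addnS nk mulSn addnC.
  rewrite nE mulnK// modnMl u0 mulg1 expgSr -uk -[in u k]nk; exact: adj_mull.
- move=> n; apply: le_trans (v_ge n).
  have : 0 <= (n %/ k)%N%:R * f a by rewrite mulr_ge0// ltW.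
  lra.
- move=> M; exists ((Num.trunc ((M + C) / f a)).+1 * k)%N => n Nn.
  apply: le_trans (v_ge n); rewrite lerBrDr -ler_pdivrMr//.
  apply: (le_trans (ltW (truncnS_gt _))); rewrite ler_nat.
  by rewrite leq_divRL.
Qed.

End pseudocharacter_facts.

Section rays.
Variables (R : realType) (G : groupType) (f : G -> R) (S : triangular_generating_set G).
Variable lam : R.
Hypothesis lam0 : 0 < lam.
Hypothesis f_adj : forall x y, adj S x y -> `|f x - f y| <= lam.
Local Notation Y := (realization R (cayley S)).
Local Notation F := (@affine_extension R G f S).
Local Notation pt x := (Vertex (x : vertex (cayley S)) : Y).

Lemma affine_extension_lipschitz (p q : Y) : `|F p - F q| <= lam * mdist p q.
Proof.
apply: (@affine_lipschitz R (cayley S) lam f) => // e; apply: f_adj.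
by exists e.2; left.
Qed.

Lemma adj_edge x y : adj S x y -> exists e (s t : R),
  [/\ 0 <= s <= 1, 0 <= t <= 1, edge_point e s = pt x & edge_point e t = pt y].
Proof.
have i1 : 0 <= (1 : R) <= 1 by rewrite ler01 lexx.
have i0 : 0 <= (0 : R) <= 1 by rewrite ler01 lexx.
move=> [s [->|->]].
- by exists ((x, s) : edge (cayley S)), 0, 1; rewrite edge_point0 edge_point1.
- by exists ((y, s) : edge (cayley S)), 1, 0; rewrite edge_point0 edge_point1.
Qed.

Lemma cayley_ray (v : nat -> G) : (forall n, v n = v n.+1 \/ adj S (v n) (v n.+1)) ->
  (forall M, exists N, forall n, (N <= n)%N -> M <= f (v n)) ->
  exists phi : R -> Y, continuous phi /\ F (phi t) @[t --> +oo] --> +oo.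
Proof.
move=> v_step v_unbd.
have edge_path n : exists g : R -> Y,
    [/\ forall s t, mdist (g s) (g t) <= `|s - t|, g 0 = pt (v n) & g 1 = pt (v n.+1)].
  case: (v_step n) => [<-|/adj_edge[e [s [t [s01 t01 sE tE]]]]].
    by exists (fun=> pt (v n)); split=> // *; rewrite mdistxx.
  exists (fun r => edge_point e (s + r * (t - s))); split.
  - move=> a b; apply: (le_trans (mdist_edge_point _ _ _)).
    rewrite opprD addrACA subrr add0r -mulrBl normrM ler_piMr// ler_norml.
    by move: s01 t01 => /andP[? ?] /andP[? ?]; apply/andP; split; lra.
  - by rewrite mul0r addr0.
  - by rewrite mul1r addrC subrK.
have [g gP] := choice edge_path.
have [||phi [phiL phiE _]] := @lipschitz_concatenation R Y 1 g ler01.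
- by move=> n s t _ _; rewrite mul1r; have [->] := gP n.
- by move=> n; have [_ _ ->] := gP n; have [_ ->] := gP n.+1.
exists phi; split; first exact: lipschitz_continuous phiL.
apply/cvgryPge => M; have [N vN] := v_unbd (M + lam).
near=> t; have t0 : 0 <= t by near: t; apply: nbhs_pinfty_ge; rewrite num_real.
have /andP[nt tn] := truncn_itv t0; set n := Num.trunc t in nt tn.
have Nn : (N <= n)%N.
  rewrite -ltnS -(ltr_nat R); apply: le_lt_trans tn.
  by near: t; apply: nbhs_pinfty_ge; rewrite num_real.
have phin : phi n%:R = pt (v n).
  by rewrite -[n%:R]addr0 phiE ?lexx ?ler01//; have [] := gP n.
have := affine_extension_lipschitz (phi n%:R) (phi t).
have : mdist (phi n%:R) (phi t) <= 1.
  rewrite -natr1 in tn; rewrite (le_trans (phiL _ _))// mul1r ler_norml.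
  by apply/andP; split; lra.
rewrite {2}phin /= => d1 /ler_normlP[? ?]; have := vN n Nn.
have : lam * mdist (phi n%:R) (phi t) <= lam by rewrite ger_pMr.
lra.
Unshelve. all: by end_near. Qed.

(** The word distance is bounded by the path metric, hence is at most two here. *)
Let adj_near (x y : G) : mdist (pt x) (pt y) < 3 ->
  joined (adj S) (fun z => f z <= f x + 2 * lam) x y.
Proof.
move=> xy3; pose d := gdist (adj_connected S).
have d2 : (d x y <= 2)%N.
  rewrite -ltnS -(ltr_nat R); apply: le_lt_trans xy3.
  have := @affine_lipschitz R (cayley S) 1 (fun z => (d x z)%:R) (pt x) (pt y) ltr01.
  have dxx : d x x = 0%N by exact: gdistxx.
  rewrite mul1r /= dxx sub0r normrN normr_nat; apply=> -[u s].
  have us : adj S u (u * val s)%g by exists s; left.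
  have := gdist_edge (adj_connected S) us.
  have := gdist_edge (adj_connected S) (adj_sym us).
  have := gdist_triangle (adj_connected S) u x (u * val s)%g.
  have := gdist_triangle (adj_connected S) (u * val s)%g x u.
  rewrite -/d ler_norml lerNl opprB !lerBlDr -!(natrD _ 1) !ler_nat /= => h1 h2 h3 h4.
  apply/andP; split; [apply: leq_trans h2 _|apply: leq_trans h1 _];
  by rewrite addnC leq_add2r.
apply: joined_sub (joined_near (adj_connected S) x y) => z xz.
have xz2 : (d x z)%:R <= 2 :> R by rewrite ler_nat (leq_trans xz).
have /ler_normlP[? ?] := gdist_lipschitz (adj_connected S) x z f_adj.
have : lam * (d x z)%:R <= lam * 2.
  by rewrite ler_wpM2l// ltW.
lra.
Qed.

Let nearest_f (p : Y) : `|F p - f (nearest p)| <= lam.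
Proof.
have := affine_extension_lipschitz p (pt (nearest p)) => /le_trans; apply.
by rewrite ger_pMr// mdist_nearest.
Qed.

(** The continuous path [phi] is followed through the nearest vertices.  If no
    vertex within [3 * lam] of the height [H] were reached from below, then being
    reachable below [H] would be a locally constant property of the time, so [phi]
    would stay below [H] forever. *)
Lemma ray_climbs (phi : R -> Y) (H : R) :
  {within `[0, +oo[, continuous phi} -> F (phi t) @[t --> +oo] --> +oo ->
  f (nearest (phi 0)) <= H ->
  exists t, [/\ 0 <= t, H - 3 * lam <= f (nearest (phi t)) &
    joined (adj S) (fun z => f z <= H) (nearest (phi 0)) (nearest (phi t))].
Proof.
move=> phic phioo H0; apply: contrapT => noclimb.
pose A t := joined (adj S) (fun z => f z <= H) (nearest (phi 0)) (nearest (phi t)).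
have low t : 0 <= t -> A t -> f (nearest (phi t)) < H - 3 * lam.
  by move=> t0 At; rewrite ltNge; apply/negP => le_t; apply: noclimb; exists t.
have l0 := lam0.
have [T T0 HT] : exists2 T, 0 <= T & H + lam < F (phi T).
  have : \forall t \near +oo, 0 <= t /\ H + lam < F (phi t).
    near=> t; split; first by near: t; apply: nbhs_pinfty_ge; rewrite num_real.
    by near: t; move/cvgryPgt: phioo; apply.
  by move=> /filter_ex[T [? ?]]; exists T.
suff /(low T T0) : A T by have /ler_normlP[? ?] := nearest_f (phi T); lra.
apply: clopen_induction => //; first by left.
move=> t /andP[t0 tT].
have tI : `[0, +oo[%classic t by rewrite /= in_itv /= t0.
have [eps eps0 near_t] := within_continuous_mdist phic tI ltr01.
exists eps => // s /andP[s0 sT] st.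
have d1 : mdist (phi t) (phi s) < 1 by apply: near_t => //; rewrite /= in_itv /= s0.
have step r r' : 0 <= r -> mdist (phi r) (phi r') < 1 -> A r -> A r'.
  move=> r0 rr Ar; apply: (joined_trans Ar).
  have near3 : mdist (pt (nearest (phi r))) (pt (nearest (phi r'))) < 3.
    have := metric_triangle (pt (nearest (phi r))) (phi r) (pt (nearest (phi r'))).
    have := metric_triangle (phi r) (phi r') (pt (nearest (phi r'))).
    have := mdist_nearest (phi r); have := mdist_nearest (phi r').
    by rewrite (metric_sym (pt (nearest (phi r))) (phi r)); lra.
  by apply: joined_sub (adj_near near3) => z; have := low r r0 Ar; lra.
by split; apply: step; rewrite // metric_sym.
Unshelve. all: by end_near. Qed.

Let joined_path (A : set Y) x y (P : G -> Prop) : joined (adj S) P x y ->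
  (forall z p, P z -> mdist (pt z) p <= 1 -> A p) -> lipschitz_path A (pt x) (pt y).
Proof.
move=> xy PA; elim: xy => [Px|y' z xy IH yz Pz].
  by apply/lipschitz_path_refl/(PA x) => //; rewrite mdistxx.
apply: (lipschitz_path_trans IH).
have [e [s [t [s01 t01 sE tE]]]] := adj_edge yz.
rewrite -sE -tE; apply: edge_lipschitz_path => // r r01.
apply: (PA y'); first exact: joined_r xy.
rewrite -sE; apply: (le_trans (mdist_edge_point _ _ _)).
by move: s01 r01 => /andP[? ?] /andP[? ?]; rewrite ler_norml; apply/andP; split; lra.
Qed.

Variables phi1 phi2 : R -> Y.
Hypothesis phi1_c : {within `[0, +oo[, continuous phi1}.
Hypothesis phi2_c : {within `[0, +oo[, continuous phi2}.
Hypothesis phi1_oo : F (phi1 t) @[t --> +oo] --> +oo.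
Hypothesis phi2_oo : F (phi2 t) @[t --> +oo] --> +oo.
Hypothesis phi_inequivalent : forall C : R, 0 < C -> exists2 H, C < H &
  ~ exists delta : R -> Y,
      [/\ {within `[0, 1], continuous delta},
          (phi1 @` `[0, +oo[) (delta 0),
          (phi2 @` `[0, +oo[) (delta 1) &
          forall t, 0 <= t <= 1 -> `|F (delta t) - H| <= C].

(** The peaks are reached by climbing the two rays to the height [c] at which they
    cannot be joined at nearly constant height; the descent of both rays and a
    fixed path between their origins joins them below [c]. *)
Lemma inequivalent_rays_split M : exists (c : R) a b,
  [/\ c - 3 * lam <= f a, c - 3 * lam <= f b,
      joined (adj S) (fun z => f z <= c) a b &
      ~ joined (adj S) (fun z => c - M <= f z <= c + lam) a b].
Proof.
have l0 := lam0.
have [m ab0] := joined_bounded f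
  (adj_connected S (nearest (phi1 0)) (nearest (phi2 0))).
have m_le := ler_norm m; have M_le := ler_norm M.
have m_ge := normr_ge0 m; have M_ge := normr_ge0 M.
(* |m| makes H higher than the fixed path between the origins; the multiple of
   lam covers the passage between points of the realization and vertices. *)
have [|H HC no_delta] := @phi_inequivalent (`|M| + 6 * lam + `|m|); first lra.
have a0H : f (nearest (phi1 0)) <= H by have := joined_l ab0; rewrite /=; lra.
have b0H : f (nearest (phi2 0)) <= H by have := joined_r ab0; rewrite /=; lra.
have [t1 [t1_0 aH a0a]] := ray_climbs phi1_c phi1_oo a0H.
have [t2 [t2_0 bH b0b]] := ray_climbs phi2_c phi2_oo b0H.
exists H, (nearest (phi1 t1)), (nearest (phi2 t2)); split=> //.
  apply: (joined_trans (joined_sym (@adj_sym _ S) a0a)); apply: joined_trans b0b.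
  by apply: joined_sub ab0 => z /=; lra.
move=> ab; apply: no_delta.
pose A := [set p : Y | `|F p - H| <= `|M| + 6 * lam + `|m|].
have end_path (phi : R -> Y) t : 0 <= t -> H - 3 * lam <= f (nearest (phi t)) ->
    f (nearest (phi t)) <= H -> lipschitz_path A (phi t) (pt (nearest (phi t))).
  move=> t0 le1 le2; apply: nearest_lipschitz_path => q pq.
  have /ler_normlP[? ?] := affine_extension_lipschitz (phi t) q.
  have /ler_normlP[? ?] := nearest_f (phi t).
  have : lam * mdist (phi t) q <= lam by rewrite ger_pMr.
  by move=> ?; rewrite /A /= ler_norml; apply/andP; split; lra.
have : path_component A (phi1 t1) (phi2 t2).
  apply: lipschitz_pathP; apply: (@lipschitz_path_trans _ _ _ (pt (nearest (phi1 t1)))).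
    by apply: end_path => //; exact: joined_r a0a.
  apply: (@lipschitz_path_trans _ _ _ (pt (nearest (phi2 t2)))); last first.
    by apply: lipschitz_path_sym; apply: end_path => //; exact: joined_r b0b.
  apply: joined_path ab _ => z p /andP[? ?] zp.
  have /ler_normlP[/= ? ?] := affine_extension_lipschitz (pt z) p.
  have : lam * mdist (pt z) p <= lam by rewrite ger_pMr.
  by move=> ?; rewrite /A /= ler_norml; apply/andP; split; lra.
move=> [delta [dc d0 d1 dA]]; exists delta; split=> //.
- by rewrite d0; exists t1 => //=; rewrite in_itv /= t1_0.
- by rewrite d1; exists t2 => //=; rewrite in_itv /= t2_0.
- by move=> t t01; apply: dA; exists t => //=; rewrite in_itv.
Qed.

End rays.

(** * Inequivalent rays and the tree *)

Lemma tree_of_inequivalent_rays (R : realType) (G : groupType) (f : G -> R)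
    (S : triangular_generating_set G) (phi1 phi2 : R -> realization R (cayley S)) :
  pseudocharacter f -> (exists g, f g != 0) ->
  {within `[0, +oo[, continuous phi1} -> {within `[0, +oo[, continuous phi2} ->
  affine_extension f (phi1 t) @[t --> +oo] --> +oo ->
  affine_extension f (phi2 t) @[t --> +oo] --> +oo ->
  (forall C : R, 0 < C -> exists2 H, C < H &
    ~ exists delta : R -> realization R (cayley S),
      [/\ {within `[0, 1], continuous delta},
          (phi1 @` `[0, +oo[) (delta 0),
          (phi2 @` `[0, +oo[) (delta 1) &
          forall t, 0 <= t <= 1 -> `|affine_extension f (delta t) - H| <= C]) ->
  exists T : connected_graph,
    [/\ tree T, bushy (realization R T) &
        exists A : G -> realization R T -> realization R T,
          quasi_action A /\ cobounded A].
Proof.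
move=> f_pc f_neq0 c1 c2 oo1 oo2 inequiv.
have [lam lam0 f_adj] := pseudocharacter_adj f_pc S.
have split_peaks := inequivalent_rays_split lam0 f_adj c1 c2 oo1 oo2 inequiv.
have [C1 [up [up0 up_step up_ge up_oo]]] := ascending_ray f_pc S f_neq0.
have [|C2 [down [down0 down_step down_ge down_oo]]] :=
  ascending_ray (pseudocharacterN f_pc) S.
  by have [g g0] := f_neq0; exists g; rewrite oppr_eq0.
have [_ [D fD]] := f_pc; have D0 : 0 <= D := le_trans (normr_ge0 _) (fD 1%g 1%g).
have f1 := pseudocharacter1 f_pc.
have C1_0 : 0 <= C1 by have := up_ge 0%N; rewrite up0 f1 oppr_le0.
have C2_0 : 0 <= C2 by have := down_ge 0%N; rewrite down0 f1 oppr0 oppr_le0.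
pose C := C1 + C2; pose K := C + 2 * D + 4 * lam.
have K_ge : 4 * lam + 2 * D <= K by rewrite /K /C; lra.
pose conn := flat_conn fD lam0 f_adj K_ge.
exists (level_tree 1%g conn); split.
- exact: level_treeP.
- apply: (@tree_bushy R G (flat S f K) (@flat_sym _ _ S f K) conn
    (@flat_mull _ _ S f K) 13 (flat_thin (K_ge := K_ge))).
  apply: (@flat_three_ended _ _ _ _ _ _ _ fD f1 lam0 f_adj K_ge C up down) => //.
  + by move=> n; apply: le_trans (up_ge n); rewrite /C; lra.
  + by move=> n; have := down_ge n; rewrite /C; lra.
  + by move=> M; have [N fN] := up_oo M; exists N; apply: fN.
  + by move=> M; have [N fN] := down_oo (- M); exists N; rewrite -lerN2; apply: fN.
- exists (@tree_action R G (flat S f K) conn); split; last exact: tree_cobounded.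
  apply: (@tree_quasi_action R G (flat S f K) (@flat_sym _ _ S f K) conn
    (@flat_mull _ _ S f K) 13 (flat_thin (K_ge := K_ge))).
Qed.

Section two_ends.
Variables (R : realType) (G : groupType) (f : G -> R) (S : triangular_generating_set G).
Hypothesis f_pc : pseudocharacter f.
Hypothesis f_neq0 : exists g, f g != 0.
Local Notation Y := (realization R (cayley S)).

Lemma affine_extensionN (p : Y) :
  affine_extension (fun g => - f g) p = - affine_extension f p.
Proof. by case: p => [//|e t] /=; rewrite !mulrN -opprD. Qed.

Lemma sigma1 (phi : R -> Y) :
  sigma f phi = 1 <-> affine_extension f (phi t) @[t --> +oo] --> +oo.
Proof.
rewrite /sigma; case: asboolP => [//|nH].
case: asboolP => _; split=> // /eqP.
  by rewrite lt_eqF// (lt_trans (ltrN10 R)).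
by rewrite eq_sym oner_eq0.
Qed.

Lemma sigmaN1 (phi : R -> Y) :
  sigma f phi = -1 <-> affine_extension f (phi t) @[t --> +oo] --> -oo.
Proof.
rewrite /sigma; case: asboolP => [H|_].
  split=> [/eqP|H'].
    by rewrite gt_eqF// (lt_trans (ltrN10 R)).
  have : \forall t \near +oo,
      0 < affine_extension f (phi t) /\ affine_extension f (phi t) < 0.
    near=> t; split; near: t; [move/cvgryPgt: H|move/cvgrNyPlt: H']; exact.
  by move=> /filter_ex[t [/lt_trans H0 /H0]]; rewrite ltxx.
by case: asboolP => // H; split=> // /eqP; rewrite eq_sym oppr_eq0 oner_eq0.
Unshelve. all: by end_near. Qed.

Lemma ray_pos : exists phi : R -> Y, rays f S phi /\ sigma f phi = 1.
Proof.
have [lam lam0 f_adj] := pseudocharacter_adj f_pc S.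
have [C [v [_ v_step _ v_oo]]] := ascending_ray f_pc S f_neq0.
have [phi [phic phi_oo]] := cayley_ray lam0 f_adj v_step v_oo.
have s1 : sigma f phi = 1 by apply/sigma1.
by exists phi; split=> //; split; [exact: continuous_subspaceT|left].
Qed.

End two_ends.

Lemma ray_neg (R : realType) (G : groupType) (f : G -> R)
    (S : triangular_generating_set G) :
  pseudocharacter f -> (exists g, f g != 0) ->
  exists phi : R -> realization R (cayley S), rays f S phi /\ sigma f phi = -1.
Proof.
move=> f_pc [g g0].
have [|phi [[phic _] /sigma1 phi_oo]] :=
  @ray_pos R G (fun g => - f g) S (pseudocharacterN f_pc).
  by exists g; rewrite oppr_eq0.
have s1 : sigma f phi = -1.
  apply/sigmaN1/cvgrNyPlt => A; move/cvgryPgt: phi_oo => /(_ (- A)).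
  by apply: filterS => t; rewrite affine_extensionN ltrN2.
by exists phi; split=> //; split=> //; right.
Qed.

(** If rays with equal signs were always equivalent, then there would be exactly
    two classes, one for each sign: both signs occur. *)
Lemma nonuniform_inequivalent (R : realType) (G : groupType) (f : G -> R)
    (S : triangular_generating_set G) :
  pseudocharacter f -> (exists g, f g != 0) -> ~ (ends f S #= `I_2)%card ->
  exists phi1 phi2 : R -> realization R (cayley S),
    [/\ rays f S phi1, rays f S phi2, sigma f phi1 = sigma f phi2 &
        ~ equiv f phi1 phi2].
Proof.
move=> f_pc f_neq0 not2; apply: contrapT => all_equiv; apply: not2.
have {}all_equiv phi psi : rays f S phi -> rays f S psi ->
    sigma f phi = sigma f psi -> equiv f phi psi.
  by move=> rphi rpsi s; apply: contrapT => H; apply: all_equiv; exists phi, psi.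
have [phip [rp sp]] := ray_pos S f_pc f_neq0.
have [phin [rn sn]] := ray_neg S f_pc f_neq0.
pose cls phi := [set psi | rays f S psi /\ equiv f phi psi].
have clsE phi psi : rays f S phi -> rays f S psi -> sigma f phi = sigma f psi ->
    cls phi = cls psi.
  move=> rphi rpsi s; apply/seteqP; split=> chi [rchi [C C0 [sE _]]]; split=> //.
    by apply: all_equiv => //; rewrite -s.
  by apply: all_equiv => //; rewrite s.
have pn : cls phip <> cls phin.
  move=> pnE; have : cls phin phip by rewrite -pnE; split=> //; apply: all_equiv.
  by move=> [_ [C C0 [+ _]]]; rewrite sp sn => E; have := ltrN10 R; lra.
have -> : ends f S = [set cls phip; cls phin].
  apply/seteqP; split=> [_ [phi rphi <-]|_ [->|->]]; last 2 first.
  - by exists phip.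
  - by exists phin.
  have [_ [s|s]] := rphi; [left|right]; apply: clsE => //.
  - by rewrite sp.
  - by rewrite sn.
rewrite card_eq_le; apply/andP; split.
  have [F] : $| {injfun [set cls phip; cls phin] >-> `I_2} |.
    apply/injfunPex; exists (fun E => if `[< E = cls phip >] then 0%N else 1%N).
      by move=> E _; rewrite /mkset /=; case: asboolP.
    have Ap : `[< cls phip = cls phip >] = true by rewrite asboolT.
    have An : `[< cls phin = cls phip >] = false by rewrite asboolF// => /esym.
    by move=> E E' /set_mem[->|->] /set_mem[->|->]; rewrite ?Ap ?An.
  exact: inj_card_le F.
have [F] : $| {injfun `I_2 >-> [set cls phip; cls phin]} |.
  apply/injfunPex; exists (fun i => if i is 0%N then cls phip else cls phin).
    by move=> [|i] _ /=; [left|right].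
  move=> [|[|i]] [|[|j]] /set_mem i2 /set_mem j2 //=; by [move/pn|move/esym/pn].
exact: inj_card_le F.
Qed.

Theorem theorem4p20 (R : realType) (G : groupType) (f : G -> R) :
  finitely_presented G ->
  pseudocharacter f ->
  ~ (forall g : G, f g = 0%R) ->
  ~ uniform f ->
  exists T : connected_graph,
    [/\ tree T,
        bushy (realization R T) &
        exists A : G -> realization R T -> realization R T,
          quasi_action A /\ cobounded A].
Proof.
move=> _ f_pc /existsNP[g /eqP g0] /existsNP[S ends2].
have f_neq0 : exists g, f g != 0 by exists g.
have [phi1 [phi2 [[c1 s1] [c2 _] s12 inequiv]]] :=
  nonuniform_inequivalent f_pc f_neq0 ends2.
have {}inequiv C : 0 < C -> exists2 H, C < sigma f phi1 * H &
    ~ exists delta : R -> realization R (cayley S),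
      [/\ {within `[0, 1], continuous delta},
          (phi1 @` `[0, +oo[) (delta 0),
          (phi2 @` `[0, +oo[) (delta 1) &
          forall t, 0 <= t <= 1 -> `|affine_extension f (delta t) - H| <= C].
  move=> C0; apply: contrapT => H; apply: inequiv; exists C => //; split=> // h Ch.
  by apply: contrapT => no_delta; apply: H; exists h.
case: s1 => s1.
- have oo1 := s1; have oo2 := s1; rewrite s12 in oo2.
  move/sigma1 in oo1; move/sigma1 in oo2.
  apply: (tree_of_inequivalent_rays f_pc f_neq0 c1 c2 oo1 oo2) => C /inequiv[H].
  by rewrite s1 mul1r => CH no_delta; exists H.
- have oo1 := s1; have oo2 := s1; rewrite s12 in oo2.
  move/sigmaN1 in oo1; move/sigmaN1 in oo2.
  have negate (phi : R -> realization R (cayley S)) :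
      affine_extension f (phi t) @[t --> +oo] --> -oo ->
      affine_extension (fun g => - f g) (phi t) @[t --> +oo] --> +oo.
    move=> /cvgrNyPlt H; apply/cvgryPgt => A; have := H (- A).
    by apply: filterS => t; rewrite affine_extensionN ltrNr.
  apply: (tree_of_inequivalent_rays (pseudocharacterN f_pc) _ c1 c2
            (negate _ oo1) (negate _ oo2)).
    by exists g; rewrite oppr_eq0.
  move=> C /inequiv[H]; rewrite s1 mulN1r => CH no_delta; exists (- H) => //.
  move=> [delta [dc d0 d1 dH]]; apply: no_delta; exists delta; split=> // t /dH.
  by rewrite affine_extensionN -opprD normrN.
Qed.
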